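(* Let $m\ge0$ be an integer, let $u\in\mathbb{W}^{m+1}(\Omega)$, $\Omega=(-1,1)$, and let $N\ge0$ be an integer. (i) If $1\le m\le N$, then $$\|u-\pi_N^Cu\|_{L^\infty(\Omega)}\le\frac{2}{m\pi}\Big(\prod_{j=1}^{m}\frac{1}{N-m+2j-1}\Big)V_L^{(m)}.$$ (ii) If $m=0$, then for all integers $N\ge1$, $$\|u-\pi_N^Cu\|_{L^\infty(\Omega)}\le V_L^{(0)}.$$ (iii) If $m\ge N+1$, then $$\|u-\pi_N^Cu\|_{L^\infty(\Omega)}\le\frac{2}{(2N+1)!!\,\pi}\sum_{n=N}^{m}c_n\frac{(2N+1)!!}{(2n+1)!!}V_L^{(n)},$$ where $c_n=1$ for all $N\le n\le m-1$ and $c_m=2$.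
   Context: $\mathbb{W}^{m+1}(\Omega)$ is the set of $u\in L^1(\Omega)$ such that $u,u',\dots,u^{(m-1)}$ are absolutely continuous on $[-1,1]$ (no condition if $m=0$) and $u^{(m)}$ is of bounded variation on $\Omega$. $V_L^{(k)}$ denotes the total variation of $u^{(k)}$ on $\Omega$, $0\le k\le m$. Chebyshev partial sum: $\pi_N^Cu(x)=\sum_{n=0}^{N}{}^{\prime}\,\hat u_n^CT_n(x)$ (the prime means the first term is halved), $\hat u_n^C=\frac{2}{\pi}\int_{-1}^1 u(x)\frac{T_n(x)}{\sqrt{1-x^2}}dx$, $T_n(x)=\cos(n\arccos x)$. $(2n+1)!!=1\cdot3\cdots(2n+1)$. *)

(* Defs.v *)
From HB Require Import structures.
From mathcomp Require Import all_boot all_order all_algebra.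
From mathcomp Require Import all_classical all_reals all_analysis.
Set Implicit Arguments.
Unset Strict Implicit.
Unset Printing Implicit Defensive.
Import Order.TTheory GRing.Theory Num.Theory numFieldNormedType.Exports.
Local Open Scope classical_set_scope.
Local Open Scope ring_scope.

Definition Omega {R : realType} : set R := `]-1, 1[.

Lemma measurable_Omega (R : realType) :
  measurable (Omega : set (measurableTypeR R)).
Proof. exact: measurable_itv. Qed.

Definition mu_Omega {R : realType} :
    {measure set (measurableTypeR R) -> \bar R} :=
  mrestr (@lebesgue_measure R) (@measurable_Omega R).

Definition Linf_norm {R : realType} (f : R -> R) : \bar R :=
  ('N[mu_Omega]_(+oo)[EFin \o f])%E.

Definition absolutely_continuous {R : realType} (a b : R) (f : R -> R) : Prop :=
  forall e : R, 0 < e -> exists2 delta : R, 0 < delta &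
    forall (n : nat) (s t : 'I_n -> R),
      (forall i, a <= s i /\ s i <= t i /\ t i <= b) ->
      (forall i j, i != j -> t i <= s j \/ t j <= s i) ->
      \sum_(i < n) (t i - s i) < delta ->
      \sum_(i < n) `|f (t i) - f (s i)| < e.

(* The partitions range over points of the open interval, so that neither the
   values of f at the endpoints -1, 1 nor its jumps there are counted. *)
Definition TV_Omega {R : realType} (f : R -> R) : \bar R :=
  ereal_sup [set total_variation p.1 p.2 f |
             p in [set p : R * R | -1 < p.1 /\ p.1 <= p.2 /\ p.2 < 1]].

(* v 0, ..., v m are versions of the derivatives u, u', ..., u^(m) of the
   element u of L^1(Omega): u is determined only almost everywhere, and the
   derivative of an absolutely continuous function exists only almost
   everywhere, so u^(m) is known only up to a null set. For 0 < k < m the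
   absolute continuity of v k fixes it everywhere on [-1, 1]. *)
Definition derivatives {R : realType} (m : nat) (u : R -> R)
    (v : nat -> R -> R) : Prop :=
  [/\ {ae @lebesgue_measure R, forall x, Omega x -> u x = v 0%N x},
      forall k, (k < m)%N -> absolutely_continuous (-1) 1 (v k) &
      forall k, (k < m)%N -> {ae @lebesgue_measure R, forall x,
        Omega x -> is_derive x (1 : R) (v k) (v k.+1 x)}].

(* W m is the space of regularity index m + 1. *)
Definition W {R : realType} (m : nat) : set (R -> R) :=
  [set u | (@lebesgue_measure R).-integrable Omega (EFin \o u) /\
           exists2 v, derivatives m u v & (TV_Omega (v m) < +oo)%E].

Definition chebyshevT {R : realType} (n : nat) (x : R) : R :=
  cos (n%:R * acos x).

Definition chebyshev_coef {R : realType} (u : R -> R) (n : nat) : R :=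
  2 / pi * \int[lebesgue_measure]_(x in (Omega : set R))
             (u x * (chebyshevT n x / Num.sqrt (1 - x ^+ 2))).

Definition chebyshev_sum {R : realType} (N : nat) (u : R -> R) (x : R) : R :=
  chebyshev_coef u 0 / 2 * chebyshevT 0 x +
  \sum_(1 <= n < N.+1) chebyshev_coef u n * chebyshevT n x.

(* (2n+1)!! *)
Definition odd_dfact (n : nat) : nat := (\prod_(j < n.+1) (2 * j + 1))%N.

(* Main.v *)
Require Import Defs.
From mathcomp Require Import all_boot all_order all_algebra.
From mathcomp Require Import all_classical all_reals all_analysis.
From mathcomp Require Import measurable_realfun ess_sup_inf.
From mathcomp Require Import lra.
Import Order.TTheory GRing.Theory Num.Theory numFieldNormedType.Exports.
Set Implicit Arguments.
Unset Strict Implicit.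
Unset Printing Implicit Defensive.
Local Open Scope classical_set_scope.
Local Open Scope ring_scope.

(** The function [u] is studied through its version [f = v 0], whose partial sums are
the same.

Coefficients. If [f] has bounded variation [V], integrating by parts against the
primitive [sin (n acos x) / n] of [- T_n / sqrt (1 - x ^ 2)], which vanishes at both
end points, gives [|a_n| <= 2 V / (pi n)] ([chebyshev_coef_TV]). The analytic
content is [bounded_variation_pairing], which replaces the Stieltjes integral
against [df]: by Jordan decomposition and layer cake, [\int (f - f c) w] is at most
the variation times a bound for the integrals of [w] over intervals that reach an
end point without crossing [c]. If [f] is absolutely continuous, integrating by
parts gives [2 n a_n (f) = a_(n-1) (f') - a_(n+1) (f')]
([chebyshev_coef_derive]), and by induction on the number [k] of derivatives
[|a_n| <= (2 V_k / pi) / ((n - k) (n - k + 2) ... (n + k))] for [n > k]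
([chebyshev_coef_smooth]). The integration by parts rests on the fundamental
theorem of calculus for absolutely continuous functions
([absolutely_continuous_FTC]).

From coefficients to the error. If [m >= 1], then [f] is Lipschitz; by the
Christoffel-Darboux formula the error at [x] is a combination of two consecutive
coefficients of the bounded difference quotient of [f] at [x], which tend to zero by
Bessel's inequality. So the series converges to [f], and the error is at most the
sum of the omitted [|a_n|] ([chebyshev_error_tail]). For [m <= N] this sum
telescopes ([step2_prod_telescope]), which is (i). For [m > N], the coefficients of
order [N < n <= m] are bounded by means of the derivative of order [n - 1] and
those beyond [m] by the telescoping sum from [m], which is (iii) if [m >= 2]. For
[m = 1] and [N = 0] the sum of these bounds is too large by a constant factor, and
the difference of [f] and its mean is estimated directly ([chebyshev_mean_error]).

Bounded variation. For (ii) the series need not converge absolutely, and the error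
is paired directly with the variation of [f]. It suffices that the error of a
Heaviside step is at most one; in the variable [acos x] it is [1 / pi] times the sum
of two values of a remainder of the sawtooth series [\sum_n sin (n s) / n], and
those are at most [pi / 2] in absolute value ([sawtooth_rest_le]). *)

(** * Absolutely continuous functions *)

Section AC.
Context {R : realType}.
Notation mu := (@lebesgue_measure R).
Implicit Types (f g h : R -> R) (a b : R).

Lemma absolutely_continuous_sub a b c d f : a <= c -> d <= b ->
  absolutely_continuous a b f -> absolutely_continuous c d f.
Proof.
move=> ac db acf e e0; have [dl dl0 H] := acf e e0.
exists dl => // n s t st dis small; apply: H => // i.
by have [? [? ?]] := st i; split; [lra|split => //; lra].
Qed.

Lemma absolutely_continuousB a b f g : absolutely_continuous a b f ->
  absolutely_continuous a b g -> absolutely_continuous a b (f \- g).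
Proof.
move=> acf acg e e0; have e20 : 0 < e / 2 by lra.
have [d1 d10 H1] := acf _ e20; have [d2 d20 H2] := acg _ e20.
exists (Num.min d1 d2); first by rewrite lt_min d10.
move=> n s t st dis; rewrite lt_min => /andP[/(H1 _ _ _ st dis) h1].
move=> /(H2 _ _ _ st dis) h2.
rewrite [e]splitr; apply: le_lt_trans (ltrD h1 h2).
rewrite -big_split/= ler_sum// => i _.
rewrite /= (_ : f (t i) - g (t i) - _ = (f (t i) - f (s i)) - (g (t i) - g (s i)));
  last by lra.
exact: ler_normB.
Qed.

(** Both factors being bounded, the increments of the product are controlled by
those of the factors: [f t * g t - f s * g s = (f t - f s) * g t + f s * (g t - g s)]. *)
Lemma absolutely_continuousM a b f g Mf Mg :
  (forall x, a <= x <= b -> `|f x| <= Mf) ->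
  (forall x, a <= x <= b -> `|g x| <= Mg) ->
  absolutely_continuous a b f ->
  absolutely_continuous a b g -> absolutely_continuous a b (f \* g).
Proof.
move=> bf bg acf acg e e0; set K := `|Mf| + `|Mg| + 1.
have K0 : 0 < K by rewrite /K; have := normr_ge0 Mf; have := normr_ge0 Mg; lra.
have e20 : 0 < e / 2 / K by rewrite divr_gt0//; lra.
have [d1 d10 H1] := acf _ e20; have [d2 d20 H2] := acg _ e20.
exists (Num.min d1 d2); first by rewrite lt_min d10.
move=> n s t st dis; rewrite lt_min => /andP[/(H1 _ _ _ st dis) h1].
move=> /(H2 _ _ _ st dis) h2.
have h3 : \sum_(i < n) `|f (t i) - f (s i)| + \sum_(i < n) `|g (t i) - g (s i)|
    < e / K.
  by apply: lt_le_trans (ltrD h1 h2) _; rewrite -mulrDl -splitr.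
rewrite -(ltr_pM2r (x := K)) // in h3; rewrite divfK ?gt_eqF// in h3.
apply: le_lt_trans h3; rewrite -big_split/= mulr_suml ler_sum// => i _.
have [? [? ?]] := st i.
rewrite /= (_ : f (t i) * g (t i) - _ = (f (t i) - f (s i)) * g (t i)
  + f (s i) * (g (t i) - g (s i))); last by lra.
apply: le_trans (ler_normD _ _) _; rewrite !normrM mulrDl lerD//.
  apply: ler_wpM2l => //; apply: le_trans (bg _ _) _; first by lra.
  by rewrite /K; have := normr_ge0 Mf; have := ler_norm Mg; lra.
rewrite mulrC; apply: ler_wpM2l => //; apply: le_trans (bf _ _) _; first by lra.
by rewrite /K; have := normr_ge0 Mg; have := ler_norm Mf; lra.
Qed.

Lemma absolutely_continuous_within a b f : a < b ->
  absolutely_continuous a b f -> {within `[a, b], continuous f}.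
Proof.
move=> ab acf.
have H : forall e, 0 < e -> exists2 d, 0 < d & forall x y, a <= x <= b ->
    a <= y <= b -> `|x - y| < d -> `|f x - f y| < e.
  move=> e e0; have [d d0 H] := acf e e0; exists d => // x y.
  wlog xy : x y / x <= y.
    move=> W; case: (leP x y) => [/W//|/ltW yx] xab yab.
    by rewrite distrC [X in _ -> X < _]distrC; exact: W.
  move=> /andP[ax xb] /andP[ay yb]; rewrite ler0_norm ?subr_le0// opprB => xyd.
  have := H 1%N (fun=> x) (fun=> y).
  rewrite !big_ord1 distrC; apply => //.
  by move=> i j; rewrite !ord1 eqxx.
apply/(continuous_within_itvP _ ab); split.
- move=> x; rewrite in_itv/= => /andP[ax xb].
  apply/cvgrPdist_lt => e e0; have [d d0 {}H] := H e e0.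
  near=> y; apply: H; [by lra| |].
    have : `|x - y| < Num.min (x - a) (b - x).
      by near: y; apply: cvgr_dist_lt => //; rewrite lt_min !subr_gt0 ax.
    by rewrite lt_min !ltr_norml; lra.
  by near: y; exact: cvgr_dist_lt.
- apply/cvgrPdist_lt => e e0; have [d d0 {}H] := H e e0.
  near=> y; apply: H; [by lra| |].
    have ay : a < y by near: y; exact: nbhs_right_gt.
    have yb : y < b by near: y; exact: nbhs_right_lt.
    lra.
  have ay : a < y by near: y; exact: nbhs_right_gt.
  rewrite ltr0_norm ?subr_lt0// opprB ltrBlDr.
  by near: y; apply: nbhs_right_lt; lra.
- apply/cvgrPdist_lt => e e0; have [d d0 {}H] := H e e0.
  near=> y; apply: H; [by lra| |].
    have yb : y < b by near: y; exact: nbhs_left_lt.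
    have ay : a < y by near: y; exact: nbhs_left_gt.
    lra.
  have yb : y < b by near: y; exact: nbhs_left_lt.
  rewrite gtr0_norm ?subr_gt0// ltrBlDr -ltrBlDl.
  by near: y; apply: nbhs_left_gt; lra.
Unshelve. all: by end_near. Qed.

End AC.

Section constancy.
Context {R : realType}.
Notation mu := (@lebesgue_measure R).
Implicit Types (f g h : R -> R) (a b : R).

(** Ordered lists of intervals, which can be extended on the right, are the
convenient form of the finite families of the definition. *)
Lemma absolutely_continuous_seq a b f : absolutely_continuous a b f ->
  forall e, 0 < e -> exists2 d, 0 < d & forall l : seq (R * R),
    all (fun p => [&& a <= p.1, p.1 <= p.2 & p.2 <= b]) l ->
    pairwise (fun p q => p.2 <= q.1) l ->
    \sum_(p <- l) (p.2 - p.1) < d -> \sum_(p <- l) `|f p.2 - f p.1| < e.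
Proof.
move=> acf e e0; have [d d0 H] := acf e e0; exists d => // l lab pl.
rewrite !(big_nth (0, 0)) !big_mkord => small.
apply: (H _ (fun i => (nth (0, 0) l i).1) (fun i => (nth (0, 0) l i).2)) => //.
- by move=> i; have /and3P[] := allP lab _ (mem_nth (0, 0) (ltn_ord i)).
- have plP := pairwiseP (0, 0) pl.
  move=> i j; rewrite neq_lt => /orP[ij|ji]; [left|right].
    by apply: (plP _ _ _ _ ij); rewrite unfold_in /=.
  by apply: (plP _ _ _ _ ji); rewrite unfold_in /=.
Qed.

Lemma ae_null_open (P : set R) (E : set R) (d : R) : 0 < d ->
  {ae mu, forall x, P x} -> mu.-negligible E ->
  exists U : set R, [/\ open U, E `<=` U, forall x, ~ U x -> P x &
    (mu U < d%:E)%E].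
Proof.
move=> d0 aeP nE; have [N [mN N0 PEN]] := negligibleU aeP nE.
have [] := lebesgue_regularity_outer mN _ d0; first by rewrite N0.
move=> U [oU NU Ud]; exists U; split => //.
- by move=> x Ex; apply: NU; apply: PEN; right.
- by move=> x Ux; apply: contrapT => Px; apply: Ux; apply: NU; apply: PEN; left.
- have mU : measurable (U : set (measurableTypeR R)) by exact: open_measurable.
  rewrite -(setDUK NU) measureU//; last 2 first.
  + exact: measurableD.
  + by rewrite setDE setICA setICr setI0.
  by rewrite [X in (X + _)%E](_ : _ = 0%E) ?add0e.
Qed.

(** A null set carries no variation of an absolutely continuous function, and
off it a vanishing derivative carries none either; the two are glued by moving
the right end [x] of an interval from [a] to [b], while collecting in [l] the
pieces on which the derivative is not under control. *)
Lemma absolutely_continuous_derive0 a b f : a <= b ->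
  absolutely_continuous a b f ->
  {ae mu, forall x, a < x < b -> is_derive x (1 : R) f 0} -> f a = f b.
Proof.
move=> ab acf f'0; apply/eqP; rewrite eq_sym -subr_eq0 -normr_le0.
apply/ler_addgt0Pr => e' e'0; rewrite add0r.
(* The total is at most [e * (b - a)] off the null set, plus [e] on it. *)
pose e := e' / (1 + (b - a)).
have e0 : 0 < e by rewrite divr_gt0//; lra.
have [d d0 small] := absolutely_continuous_seq acf e0.
(* Nothing is known of the derivative at the end points, so they join the null set. *)
have nab : mu.-negligible [set a; b].
  apply/negligibleP; first by apply: measurableU; exact: measurable_set1.
  apply: countable_lebesgue_measure0; exact/finite_set_countable/finite_set2.
have [U [oU abU UP Ud]] := ae_null_open d0 f'0 nab.
have mU : measurable (U : set (measurableTypeR R)) by exact: open_measurable.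
pose lam x := fine (mu (U `&` `]a, x])).
have mI (x : R) : measurable (U `&` `]a, x] : set (measurableTypeR R)).
  exact: measurableI.
have lamfin x : mu (U `&` `]a, x]) \is a fin_num.
  rewrite ge0_fin_numE// (le_lt_trans (le_measure mu _ _ (@subIsetl _ U _)))//;
    rewrite ?inE//.
  exact: lt_trans Ud (ltry _).
have lamd x : lam x < d.
  rewrite -lte_fin fineK//; apply: le_lt_trans Ud.
  by apply: le_measure; rewrite ?inE.
have lam_mono x y : x <= y -> lam x <= lam y.
  move=> xy; apply: fine_le => //; apply: le_measure; rewrite ?inE//.
  by apply: setIS; apply: subset_itvl; rewrite bnd_simp.
have lam_step x y : a <= x -> x <= y -> `[x, y] `<=` U -> lam x + (y - x) <= lam y.
  move=> ax xy xyU; rewrite -lee_fin EFinD !fineK//.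
  have -> : ((y - x)%:E = mu `]x, y])%E.
    rewrite lebesgue_measure_itv/= lte_fin; case: ltP => // yx.
    by rewrite (_ : y = x) ?subrr//; apply/eqP; rewrite eq_le xy yx.
  rewrite -measureU//; last 1 first.
  - rewrite -subset0 => z [[_]]; rewrite /= !in_itv/= => /andP[_ zx] /andP[xz _].
    by have := le_lt_trans zx xz; rewrite ltxx.
  apply: le_measure; rewrite ?inE//; first by apply: measurableU.
  move=> z [[Uz]|]; rewrite /= in_itv/= => /andP[z1 z2].
    by split => //=; rewrite in_itv/= z1/= (le_trans z2 xy).
  split => /=; first by apply: xyU; rewrite /= in_itv/= (ltW z1) z2.
  by rewrite in_itv/= z2 (le_lt_trans ax z1).
pose P x := exists l : seq (R * R),
  [/\ all (fun p => [&& a <= p.1, p.1 <= p.2 & p.2 <= x]) l,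
    pairwise (fun p q => p.2 <= q.1) l,
    \sum_(p <- l) (p.2 - p.1) <= lam x &
    `|f x - f a| <= e * (x - a) + \sum_(p <- l) `|f p.2 - f p.1|].
have step x y : a <= x -> x <= y ->
    `|f y - f x| <= e * (y - x) \/ `[x, y] `<=` U -> P x -> P y.
  move=> ax xy xyP [l [lx pl ls lf]].
  have lall : all (fun p => [&& a <= p.1, p.1 <= p.2 & p.2 <= y]) l.
    apply: sub_all lx => p /and3P[-> -> px] /=; exact: le_trans px xy.
  have fyx : `|f y - f a| <= `|f y - f x| + `|f x - f a| by exact: ler_distD.
  case: xyP => [fxy|xyU]; [exists l|exists (rcons l (x, y))]; split => //.
  - exact: le_trans ls (lam_mono _ _ xy).
  - by lra.
  - by rewrite all_rcons/= ax xy lexx.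
  - rewrite pairwise_rcons pl andbT; apply: sub_all lx => p /and3P[] //.
  - by rewrite big_rcons/=; have := lam_step _ _ ax xy xyU; lra.
  - by rewrite big_rcons/=; nra.
(* [P] propagates a little beyond every point, so its supremum is [b]. *)
pose S := [set x | a <= x <= b /\ P x].
have Pa : P a.
  exists [::]; split => //; first by rewrite big_nil fine_ge0.
  by rewrite !subrr normr0 big_nil; lra.
have Sa : S a by split => //; rewrite lexx.
have hsS : has_sup S.
  by split; [exists a|exists b => x [/andP[]]].
set c := sup S.
have cP x : S x -> x <= c by move=> Sx; exact: (sup_upper_bound hsS).
have ac : a <= c by exact: cP.
have cb : c <= b by apply: ge_sup; [exists a|move=> x [/andP[]]].
have [r r0 gauge] : exists2 r, 0 < r & forall x y, c - r < x -> x <= y ->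
    y < c + r -> x = c \/ y = c ->
    `|f y - f x| <= e * (y - x) \/ `[x, y] `<=` U.
  have [Uc|Uc] := pselect (U c).
    have [r /= r0 cr] := open_itvoo_subset oU Uc.
    exists (r / 2); first by lra.
    move=> x y cx xy yc _; right => z/=; rewrite in_itv/= => /andP[xz zy].
    apply: (cr (r / 2)) => //=; rewrite ?in_itv/=; [|lra|lra].
    by rewrite sub0r normrN gtr0_norm; lra.
  have nca : c != a by apply/eqP => ca; apply: Uc; apply: abU; left.
  have ncb : c != b by apply/eqP => cb'; apply: Uc; apply: abU; right.
  have acb : a < c < b by rewrite !lt_neqAle eq_sym nca ac ncb.
  have [dfc f'c] := UP _ Uc acb.
  have fl : h^-1 *: (f (h *: (1 : R) + c) - f c) @[h --> 0^'] --> 'D_1 f c.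
    exact: dfc.
  rewrite f'c in fl.
  move/cvgrPdist_le : fl => /(_ _ e0) [r /= r0 fr].
  exists r => // x y cx xy yc xyc; left.
  have H z : `|z - c| < r -> `|f z - f c| <= e * `|z - c|.
    move=> zc; have [->|zc0] := eqVneq z c; first by rewrite !subrr normr0 mulr0.
    have := fr (z - c); rewrite /ball_/= sub0r normrN subr_eq0 => /(_ zc zc0).
    rewrite scaler1 subrK sub0r normrN normrZ normfV.
    rewrite mulrC ler_pdivrMr// normr_gt0 subr_eq0//.
  case: xyc => ?; subst.
    have := H y; rewrite ger0_norm ?subr_ge0//; apply; lra.
  have := H x; rewrite ler0_norm ?subr_le0// opprB distrC; apply; lra.
have Pc : P c.
  have [x Sx xc] := sup_adherent r0 hsS.
  have [/andP[ax xb] Px] := Sx.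
  have xc' : x <= c by exact: cP.
  apply: step Px => //; apply: gauge => //; [|by right]; lra.
have cb' : c = b.
  apply/eqP; rewrite eq_le cb leNgt; apply/negP => cb'.
  pose y := Num.min b (c + r / 2).
  have cy : c < y by rewrite lt_min cb'; lra.
  have : S y.
    split; first by rewrite (le_trans ac (ltW cy)) ge_min lexx.
    apply: step Pc => //; [exact: ltW|]; apply: gauge; [lra|exact: ltW| |by left].
    by rewrite gt_min; apply/orP; right; lra.
  by move=> /cP; rewrite leNgt cy.
move: Pc; rewrite cb' => -[l [lx pl ls lf]].
have := small l lx pl (le_lt_trans ls (lamd b)).
have -> : e' = e * (1 + (b - a)) by rewrite divfK//; apply/lt0r_neq0; lra.
by lra.
Qed.

End constancy.

Section primitive.
Context {R : realType}.
Notation mu := (@lebesgue_measure R).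
Implicit Types (f g h : R -> R) (a b : R).

Lemma integrable_patch (D : set R) g : measurable (D : set (measurableTypeR R)) ->
  mu.-integrable D (EFin \o g) -> mu.-integrable setT (EFin \o (g \_ D)).
Proof.
move=> mD /(integrable_mkcond _ mD); congr integrable.
by apply/funext => x; rewrite /patch /=; case: ifP.
Qed.

(** The absolute continuity of the integral as a set function, applied to the
union of the intervals of the family. *)
Lemma absolutely_continuous_primitive a b g : mu.-integrable setT (EFin \o g) ->
  absolutely_continuous a b (fun x => \int[mu]_(t in `]a, x]) g t).
Proof.
move=> ig e e0; have [d [d0 H]] := integral_normr_continuous ig e0.
exists d => // n s t st dis small.
pose I i := `]s i, t i]%classic : set (measurableTypeR R).
have mI i : measurable (I i) by exact: measurable_itv.
have tI : trivIset setT I.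
  apply/trivIsetP => i j _ _ ij; rewrite -subset0 => x [].
  rewrite /I /= !in_itv/= => /andP[x1 x2] /andP[x3 x4].
  by case: (dis i j ij) => h; lra.
pose D := \big[setU/set0]_(i < n) I i.
have mD : measurable D by exact: bigsetU_measurable.
have muD : (mu D < d%:E)%E.
  rewrite /D measure_bigsetU_ord//.
  rewrite (eq_bigr (fun i => (t i - s i)%:E)); first by rewrite sumEFin lte_fin.
  move=> i _; have [_ [st' _]] := st i.
  rewrite /I; transitivity (mu `]s i, t i]); first by [].
  rewrite lebesgue_measure_itv/= lte_fin; case: ltP => // ts.
  by rewrite (_ : t i = s i) ?subrr//; apply/eqP; rewrite eq_le ts st'.
have igS (A : set (measurableTypeR R)) : measurable A ->
    mu.-integrable A (EFin \o g) by move=> mA; exact: integrableS ig.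
have iagS (A : set (measurableTypeR R)) : measurable A ->
    mu.-integrable A (EFin \o (Num.norm \o g)).
  by move=> mA; apply: integrable_norm; exact: igS.
apply: le_lt_trans (H _ mD muD).
rewrite (_ : (\int[mu]_(x in D) `|g x|) =
    \sum_(i < n) \int[mu]_(x in I i) `|g x|).
  apply: ler_sum => i _; have [as_ [st' tb]] := st i.
  rewrite Rintegral_itvB ?bnd_simp//; last exact: igS.
  by apply: le_normr_Rintegral => //; exact: igS.
rewrite /Rintegral /D integral_bigsetU_EFin//.
- rewrite -sum_fine// => i _; apply: integrable_fin_num => //; exact: iagS.
- exact: index_enum_uniq.
- exact: sub_trivIset tI.
- by apply: measurable_int (iagS _ mD).
Qed.

(** Subtracting from [f] the indefinite integral of [g], which is absolutely
continuous and has derivative [g] almost everywhere by Lebesgue differentiation,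
leaves a function with vanishing derivative. *)
Lemma absolutely_continuous_FTC a b f g : absolutely_continuous a b f ->
  mu.-integrable `]a, b[ (EFin \o g) ->
  {ae mu, forall x, a < x < b -> is_derive x (1 : R) f (g x)} ->
  forall x, a <= x <= b -> \int[mu]_(t in `]a, x[) g t = f x - f a.
Proof.
move=> acf ig f'g x /andP[ax xb].
pose G := g \_ `]a, b[.
have iG : mu.-integrable setT (EFin \o G) by exact: integrable_patch.
have iGS (A : set (measurableTypeR R)) : measurable A ->
  mu.-integrable A (EFin \o G) by move=> mA; exact: integrableS iG.
pose F y := \int[mu]_(t in `]a, y]) G t.
have F'G := @FTC1 R G (BRight a) (fun y => iGS _ (measurable_itv _))
  (open_integrable_locally openT iG).
have := @absolutely_continuous_derive0 R a x (f \- F) ax.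
have -> : (f \- F) a = f a.
  by rewrite /F/= set_itvoc0 Rintegral_set0 subr0.
have -> : (f \- F) x = f x - \int[mu]_(t in `]a, x[) g t.
  rewrite /F /= -Rintegral_itv_bndo_bndc; last exact: iGS.
  congr (_ - _); apply: eq_Rintegral => y; rewrite inE/= in_itv/= => /andP[ay yx].
  by rewrite /G patchE mem_set//= in_itv/= ay (lt_le_trans yx xb).
move=> ->; first by lra.
  apply: (@absolutely_continuous_sub _ a b) => //.
  by apply: absolutely_continuousB => //; exact: absolutely_continuous_primitive.
apply: (@filterS2 _ _ (ae_filter_ringOfSetsType mu) _ _ _ _ f'g F'G) => y {}f'g {}F'G /andP[ay yx].
have [dF F'] := F'G ay.
have aby : a < y < b by rewrite ay (lt_le_trans yx xb).
have Gy : G y = g y by rewrite /G patchE mem_set//= in_itv.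
have dFy : is_derive y (1 : R) F (g y) by split; [exact: dF|rewrite -derive1E F' Gy].
have dfy := f'g aby.
by rewrite -(subrr (g y)); exact: is_deriveB.
Qed.

End primitive.

(** * Antiderivatives of functions singular at the end points *)

Section singular_endpoints.
Context {R : realType}.
Notation mu := (@lebesgue_measure R).
Variables (a b : R) (F f : R -> R).
Hypothesis ab : a < b.
Hypothesis cF : {within `[a, b], continuous F}.
Hypothesis F'f : forall x, a < x < b -> is_derive x (1 : R) F (f x).

Lemma derive_ge0_nondecreasing : (forall x, a < x < b -> 0 <= f x) ->
  forall x y, a <= x -> x <= y -> y <= b -> F x <= F y.
Proof.
move=> f0; apply: ger0_derive1_ndecr => // x; rewrite in_itv/= => xab.
  by have [] := F'f xab.
by rewrite derive1E; have [_ ->] := F'f xab; exact: f0.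
Qed.

Hypothesis cf : forall x, a < x < b -> {for x, continuous f}.

Lemma measurable_derivative :
  measurable_fun (`]a, b[ : set (measurableTypeR R)) f.
Proof.
apply: open_continuous_measurable_fun; first exact: interval_open.
by move=> x; rewrite inE/= in_itv/=; exact: cf.
Qed.

(** Monotone convergence along compact subintervals, on each of which the
integral is an increment of the nondecreasing function [F]. *)
Lemma ge0_derivative_integrable : (forall x, a < x < b -> 0 <= f x) ->
  mu.-integrable `]a, b[ (EFin \o f).
Proof.
move=> f0; have Fle := derive_ge0_nondecreasing f0.
have mf := measurable_derivative.
apply/integrableP; split; first exact/measurable_EFinP.
pose d (n : nat) := (b - a) / (n%:R + 3).
have n30 (n : nat) : 0 < n%:R + 3 :> R by rewrite ltr_wpDl.
have d0 n : 0 < d n by rewrite divr_gt0 ?subr_gt0.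
have d2 n : d n * 2 < b - a.
  rewrite /d mulrAC ltr_pdivrMr// ltr_pM2l ?subr_gt0//.
  by rewrite -[ltLHS]add0r ler_ltD// ltr_nat.
pose I n := `[a + d n, b - d n]%classic : set (measurableTypeR R).
have Iab n : I n `<=` `]a, b[.
  move=> x; rewrite /I /= !in_itv/= => /andP[x1 x2].
  by have := d0 n; lra.
have mI n : measurable (I n) by exact: measurable_itv.
have UI : \bigcup_i I i = `]a, b[%classic.
  apply/seteqP; split; first by apply: bigcup_sub => i _; exact: Iab.
  move=> x; rewrite /= in_itv/= => /andP[ax xb].
  pose e := Num.min (x - a) (b - x).
  have e0 : 0 < e by rewrite lt_min !subr_gt0 ax.
  have [n nP] : exists n, d n < e.
    exists (Num.truncn ((b - a) / e)); rewrite /d ltr_pdivrMr// mulrC.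
    rewrite -ltr_pdivrMr//; apply: lt_trans (truncnS_gt _) _.
    by rewrite -natr1; lra.
  exists n => //; rewrite /I /= in_itv/=.
  by move: nP; rewrite /e lt_min; lra.
have ndI : {homo I : n m / (n <= m)%N >-> (n <= m)%O}.
  move=> n m nm; apply/subsetPset; apply: subset_itv; rewrite bnd_simp.
    rewrite lerD2l /d ler_pM2l ?subr_gt0// lef_pV2 ?posrE// lerD2r ler_nat//.
  rewrite lerD2l lerN2 /d ler_pM2l ?subr_gt0// lef_pV2 ?posrE// lerD2r ler_nat//.
have -> : (\int[mu]_(x in `]a, b[) `|(EFin \o f) x|)%E =
    (\int[mu]_(x in `]a, b[) (f x)%:E)%E.
  apply: eq_integral => x; rewrite inE/= in_itv/= => xab.
  by rewrite ger0_norm// f0.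
rewrite -UI; have := @ge0_nondecreasing_set_cvg_integral _ _ _ I (EFin \o f) mu ndI mI.
move=> cvgI; apply: (@le_lt_trans _ _ (F b - F a)%:E); last exact: ltry.
have {}cvgI := cvgI
  (fun i => measurable_funS (measurable_itv _) (@Iab i) ((measurable_EFinP _ _).2 mf)).
rewrite -(cvg_lim (@ereal_hausdorff R) (cvgI _)); last first.
  by move=> i x /Iab; rewrite /= in_itv/= => /f0; rewrite lee_fin.
apply: lime_le.
  apply: cvgP; apply: cvgI.
  by move=> i x /Iab; rewrite /= in_itv/= => /f0; rewrite lee_fin.
apply: nearW => n.
have adb : a + d n < b - d n by have := d2 n; lra.
rewrite /I (@continuous_FTC2 _ f F)//.
- rewrite -EFinB lee_fin lerB// Fle//; have := d0 n; have := d2 n; lra.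
- apply: continuous_in_subspaceT => x; rewrite inE/= in_itv/= => xab.
  by apply: cf; have := d0 n; lra.
- have FC x : a < x < b -> {for x, continuous F}.
    move=> xab; apply: differentiable_continuous; apply/derivable1_diffP.
    by have [] := F'f xab.
  have [] := d2 n; have := d0 n => ? ?; split.
  + by move=> x; rewrite in_itv/= => xab; have [|] := F'f (x := x); first lra.
  + by apply: cvg_at_right_filter; apply: FC; lra.
  + by apply: cvg_at_left_filter; apply: FC; lra.
- move=> x; rewrite in_itv/= => xab.
  rewrite derive1E; have [|_ ->//] := F'f (x := x).
  by have := d0 n; lra.
Qed.

Hypothesis intf : mu.-integrable `]a, b[ (EFin \o f).

(** The derivative may blow up at the end points: [F] is recovered from the
interior by continuity, the indefinite integral being continuous as well. *)
Lemma integrable_derivative_absolutely_continuous :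
  absolutely_continuous a b F.
Proof.
pose G := f \_ `]a, b[.
have iG : mu.-integrable setT (EFin \o G) by exact: integrable_patch.
have iGS (A : set (measurableTypeR R)) : measurable A ->
  mu.-integrable A (EFin \o G) by move=> mA; exact: integrableS iG.
pose P x := \int[mu]_(t in `]a, x]) G t.
have acP : absolutely_continuous a b P by exact: absolutely_continuous_primitive.
have cP := absolutely_continuous_within ab acP.
have P'G x : a < x < b -> is_derive x (1 : R) P (f x).
  move=> xab.
  have Gx : G x = f x by rewrite /G patchE mem_set//= in_itv.
  have [|||] := @continuous_FTC1 _ G (BRight a) x b _ (iGS _ (measurable_itv _)).
  - by lra.
  - move: xab => /andP[ax _]; exact: ax.
  - rewrite /prop_for /continuous_at Gx; apply: cvg_trans (cf xab).
    apply: near_eq_cvg; near=> y; rewrite /G patchE mem_set//=.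
    by near: y; apply: near_in_itvoo; rewrite in_itv.
  by move=> dP P'; split => //; rewrite -derive1E P'.
pose H := F \- P.
have cH : {within `[a, b], continuous H}.
  by move=> x; apply: continuousB; [exact: cF|exact: cP].
have H'0 x : a < x < b -> is_derive x (1 : R) H 0.
  move=> xab; rewrite -(subrr (f x)); have ? := F'f xab; have ? := P'G _ xab.
  exact: is_deriveB.
have HE x : a <= x <= b -> H x = H a.
  move=> /andP[ax xb]; apply/eqP; rewrite eq_le; apply/andP; split.
    apply: (@ler0_derive1_nincr _ H a b) => // y; rewrite in_itv/= => yab.
      by have [] := H'0 _ yab.
    by rewrite derive1E; have [_ ->] := H'0 _ yab.
  apply: (@ger0_derive1_ndecr _ H a b) => // y; rewrite in_itv/= => yab.
    by have [] := H'0 _ yab.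
  by rewrite derive1E; have [_ ->] := H'0 _ yab.
move=> e e0; have [d d0 small] := acP e e0; exists d => // n s t st dis sd.
have := small n s t st dis sd; congr (_ < _); apply: eq_bigr => i _.
have [? [? ?]] := st i.
have := HE (s i); have := HE (t i); rewrite /H/= => h1 h2.
by congr (`| _ |); have := h1 ltac:(lra); have := h2 ltac:(lra); lra.
Unshelve. all: by end_near. Qed.

Lemma integrable_derivative_FTC x : a <= x <= b ->
  \int[mu]_(t in `]a, x[) f t = F x - F a.
Proof.
apply: absolutely_continuous_FTC intf _ x.
  exact: integrable_derivative_absolutely_continuous.
by apply: aeW => x; exact: F'f.
Qed.

End singular_endpoints.

(** * The Chebyshev weight *)

Section chebyshev_weight.
Context {R : realType}.
Notation mu := (@lebesgue_measure R).
Implicit Types (f g : R -> R) (x y : R) (n : nat).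

Definition weight x : R := (Num.sqrt (1 - x ^+ 2))^-1.

(** The function [U_(n-1) (x) * sqrt (1 - x ^ 2) / n], with [U] the Chebyshev
polynomials of the second kind: the primitive of [- T_n * weight] that vanishes
at [-1] and [1]. *)
Definition chebyshevS n x : R := sin (n%:R * acos x) / n%:R.

Lemma OmegaE x : (Omega x : Prop) = (-1 < x < 1).
Proof. by rewrite /Omega /= in_itv. Qed.

Lemma subr_sqr_gt0 x : -1 < x < 1 -> 0 < 1 - x ^+ 2.
Proof. by move=> /andP[x1 x2]; rewrite subr_gt0 expr2; nra. Qed.

Lemma weight_gt0 x : -1 < x < 1 -> 0 < weight x.
Proof. by move=> x1; rewrite invr_gt0 sqrtr_gt0 subr_sqr_gt0. Qed.

Lemma continuous_weight x : -1 < x < 1 -> {for x, continuous weight}.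
Proof.
move=> x1; apply: continuousV; first by rewrite gt_eqF// sqrtr_gt0 subr_sqr_gt0.
apply: (@continuous_comp _ _ _ (fun y => 1 - y ^+ 2) Num.sqrt).
  apply: continuousB; first exact: cst_continuous.
  exact: exprn_continuous.
exact: sqrt_continuous.
Qed.

Lemma is_derive_acos x : -1 < x < 1 -> is_derive x (1 : R) acos (- weight x).
Proof. by move=> x1; exact: is_derive1_acos. Qed.

(** The inverse of a continuous injection of a segment is continuous, also at the
end points, where [acos] has no derivative. *)
Lemma within_continuous_acos : {within `[-1, 1], continuous (@acos R)}.
Proof.
rewrite -cospi -[X in `[_, X]%classic]cos0.
apply: (@segment_can_ge_continuous _ 0 pi (@cos R)); first exact: pi_ge0.
  exact/continuous_subspaceT/continuous_cos.
exact: cosK.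
Qed.

Lemma acos_itv x : -1 < x < 1 -> 0 < acos x < pi.
Proof. by move=> x1; rewrite acos_gt0 ?acos_ltpi//; lra. Qed.

(** [- acos] is a primitive of the weight, continuous up to the end points. *)
Lemma weight_integrable : mu.-integrable (Omega : set R) (EFin \o weight).
Proof.
apply: (@ge0_derivative_integrable R (-1) 1 (\- acos)).
- lra.
- by move=> x; apply: continuousN; exact: within_continuous_acos.
- move=> x x1; rewrite -[weight x]opprK; have ? := is_derive_acos x1.
  exact: is_deriveN.
- by move=> x; exact: continuous_weight.
- by move=> x x1; rewrite ltW// weight_gt0.
Qed.

(** The weight being integrable, this algebra of functions is a domain on which
integration against the weight is linear without further side conditions. *)
Definition bounded_measurable f : Prop :=
  measurable_fun (Omega : set (measurableTypeR R)) f /\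
  exists M, forall x, Omega x -> `|f x| <= M.

Lemma bounded_measurableD f g : bounded_measurable f ->
  bounded_measurable g -> bounded_measurable (f \+ g).
Proof.
move=> [mf [M Mf]] [mg [K Kg]]; split; first exact: measurable_funD.
exists (M + K) => x Ox; apply: le_trans (ler_normD _ _) _.
by rewrite lerD ?Mf ?Kg.
Qed.

Lemma bounded_measurableB f g : bounded_measurable f ->
  bounded_measurable g -> bounded_measurable (f \- g).
Proof.
move=> [mf [M Mf]] [mg [K Kg]]; split; first exact: measurable_funB.
exists (M + K) => x Ox; apply: le_trans (ler_normB _ _) _.
by rewrite lerD ?Mf ?Kg.
Qed.

Lemma bounded_measurableM f g : bounded_measurable f ->
  bounded_measurable g -> bounded_measurable (f \* g).
Proof.
move=> [mf [M Mf]] [mg [K Kg]]; split; first exact: measurable_funM.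
by exists (M * K) => x Ox; rewrite /= normrM ler_pM ?Mf ?Kg.
Qed.

Lemma bounded_measurable_cst c : bounded_measurable (fun=> c).
Proof. by split; [exact: measurable_cst|exists `|c|]. Qed.

Lemma bounded_measurable_sum (I : Type) (r : seq I) (P : pred I) (F : I -> R -> R) :
  (forall i, bounded_measurable (F i)) ->
  bounded_measurable (fun x => \sum_(i <- r | P i) F i x).
Proof.
move=> bF; elim: r => [|i r IH].
  under eq_fun do rewrite big_nil; exact: bounded_measurable_cst.
under eq_fun do rewrite big_cons; case: (P i) => //.
exact: bounded_measurableD.
Qed.

Lemma within_continuous_bounded f : {within `[-1, 1], continuous f} ->
  exists M, forall x, -1 <= x <= 1 -> `|f x| <= M.
Proof.
move=> cf; have le11 : -1 <= 1 :> R by lra.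
have [c _ cP] := EVT_max le11 cf; have [d _ dP] := EVT_min le11 cf.
exists (`|f c| + `|f d|) => x x1.
have xcc : x \in `[-1, 1] by rewrite in_itv/=; lra.
have := cP x xcc; have := dP x xcc.
have := ler_norm (f c); have := ler_norm (- f d); rewrite normrN.
have := normr_ge0 (f c); have := normr_ge0 (f d).
by rewrite ler_norml; lra.
Qed.

Lemma bounded_measurable_continuous f :
  {within `[-1, 1], continuous f} -> bounded_measurable f.
Proof.
move=> cf; split; last first.
  have [M fM] := within_continuous_bounded cf.
  by exists M => x; rewrite OmegaE => x1; apply: fM; lra.
apply: (@measurable_funS _ _ _ _ (`[-1, 1]%classic : set (measurableTypeR R))).
- exact: measurable_itv.
- exact: subset_itv_oo_cc.
- by apply: subspace_continuous_measurable_fun => //; exact: measurable_itv.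
Qed.

Lemma bounded_measurable_integrable f g : bounded_measurable f ->
  mu.-integrable (Omega : set R) (EFin \o g) ->
  mu.-integrable (Omega : set R) (EFin \o (f \* g)).
Proof.
move=> [mf [M Mf]] ig; have mO := @measurable_Omega R.
have ig' : mu.-integrable (Omega : set R) (EFin \o (fun x => M * g x)).
  by have := @integrableZl _ _ _ mu _ mO M _ ig; under eq_fun do rewrite -EFinM.
apply: le_integrable ig' => //.
  apply/measurable_EFinP; apply: measurable_funM => //.
  by apply/measurable_EFinP; exact: (measurable_int mu).
move=> x Ox /=; rewrite lee_fin !normrM ler_wpM2r// (le_trans (Mf _ Ox))//.
exact: ler_norm.
Qed.

Lemma chebyshevT_max n x : `|chebyshevT n x| <= 1.
Proof. exact: cos_max. Qed.

Lemma continuous_chebyshevT n x : -1 < x < 1 -> {for x, continuous (chebyshevT n)}.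
Proof.
move=> x1; apply: (@continuous_comp _ _ _ (fun y => n%:R * acos y) cos).
  by apply: continuousM; [exact: cst_continuous|exact: continuous_acos].
exact: continuous_cos.
Qed.

Lemma bounded_measurable_chebyshevT n : bounded_measurable (chebyshevT n).
Proof.
split; last by exists 1 => x _; exact: chebyshevT_max.
apply: open_continuous_measurable_fun; first exact: interval_open.
by move=> x; rewrite inE OmegaE; exact: continuous_chebyshevT.
Qed.

Lemma is_derive_chebyshevS n x : (0 < n)%N -> -1 < x < 1 ->
  is_derive x (1 : R) (chebyshevS n) (- (chebyshevT n x * weight x)).
Proof.
move=> n0 x1; have ? := is_derive_acos x1.
rewrite /chebyshevS.
apply: is_derive_eq.
rewrite /chebyshevT /GRing.scale/= .
by rewrite mulr0 add0r !mulrN mulrCA mulKf// pnatr_eq0 -lt0n.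
Qed.

Lemma within_continuous_chebyshevS n :
  {within `[-1, 1], continuous (chebyshevS n)}.
Proof.
pose h (t : R) := sin (n%:R * t) / n%:R.
suff ch : continuous h.
  apply: (@within_continuous_comp _ _ _ _ (@acos R) h _ within_continuous_acos).
  by move=> y _; exact: ch.
move=> x; apply: (@cvgM R _ (nbhs x) _ (fun t => sin (n%:R * t)) (fun=> n%:R^-1)).
  apply: (@continuous_comp _ _ _ (fun t : R => n%:R * t) sin).
    exact: mulrl_continuous.
  exact: continuous_sin.
exact: cvg_cst.
Qed.

End chebyshev_weight.

(** * Chebyshev means and orthogonality *)

Section chebyshev_integrals.
Context {R : realType}.
Notation mu := (@lebesgue_measure R).
Implicit Types (f g q : R -> R) (x y : R) (n m N : nat).

Lemma Rintegral_oo_split f x : mu.-integrable (Omega : set R) (EFin \o f) ->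
  Omega x -> \int[mu]_(y in Omega) f y =
    \int[mu]_(y in `]-1, x[) f y + \int[mu]_(y in `]x, 1[) f y.
Proof.
rewrite OmegaE => iF x1; rewrite (@Rintegral_itv_bndo_bndc _ (BRight (-1)) x).
  rewrite -(@Rintegral_itvB _ f (BRight (-1)) (BLeft 1) x) ?bnd_simp; [|by []|lra|lra].
  by rewrite addrC subrK.
apply: integrableS iF; [exact: measurable_itv|exact: measurable_itv|].
by apply: subset_itvl; rewrite bnd_simp; lra.
Qed.

Section antiderivative.
Variables F f : R -> R.
Hypothesis cF : {within `[-1, 1], continuous F}.
Hypothesis F'f : forall x, -1 < x < 1 -> is_derive x (1 : R) F (f x).
Hypothesis cf : forall x, -1 < x < 1 -> {for x, continuous f}.
Hypothesis iF : mu.-integrable (Omega : set R) (EFin \o f).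

Lemma Rintegral_left x : -1 <= x <= 1 ->
  \int[mu]_(y in `]-1, x[) f y = F x - F (-1).
Proof.
apply: integrable_derivative_FTC => //; lra.
Qed.

Lemma Rintegral_right x : -1 < x < 1 ->
  \int[mu]_(y in `]x, 1[) f y = F 1 - F x.
Proof.
move=> x1; have Ox : Omega x by rewrite OmegaE.
have := Rintegral_oo_split iF Ox; rewrite /Omega !Rintegral_left; lra.
Qed.

End antiderivative.

(** The Chebyshev mean, of total mass [pi]. *)
Definition wint f : R := \int[mu]_(x in Omega) (f x * weight x).

Lemma bounded_measurable_weight f : bounded_measurable f ->
  mu.-integrable (Omega : set R) (EFin \o (f \* weight)).
Proof.
by move=> bf; apply: bounded_measurable_integrable => //; exact: weight_integrable.
Qed.

Lemma eq_wint f g : (forall x, Omega x -> f x = g x) -> wint f = wint g.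
Proof. by move=> fg; apply: eq_Rintegral => x; rewrite inE => /fg ->. Qed.

Lemma wintD f g : bounded_measurable f -> bounded_measurable g ->
  wint (f \+ g) = wint f + wint g.
Proof.
move=> bf bg; rewrite -RintegralD; [|exact: measurable_Omega|exact: bounded_measurable_weight..].
by apply: eq_Rintegral => x _; rewrite mulrDl.
Qed.

Lemma wintZ c f : bounded_measurable f -> wint (fun x => c * f x) = c * wint f.
Proof.
move=> bf; rewrite -RintegralZl; [|exact: measurable_Omega|exact: bounded_measurable_weight].
by apply: eq_Rintegral => x _; rewrite mulrA.
Qed.

Lemma bounded_measurableZ c f : bounded_measurable f -> bounded_measurable (fun x => c * f x).
Proof. by apply: bounded_measurableM; exact: bounded_measurable_cst. Qed.

Lemma wintB f g : bounded_measurable f -> bounded_measurable g ->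
  wint (f \- g) = wint f - wint g.
Proof.
move=> bf bg; rewrite -mulN1r -wintZ// -wintD//; last exact: bounded_measurableZ.
by apply: eq_wint => x _ /=; rewrite mulN1r.
Qed.

Lemma wint_sum (I : Type) (r : seq I) (F : I -> R -> R) :
  (forall i, bounded_measurable (F i)) ->
  wint (fun x => \sum_(i <- r) F i x) = \sum_(i <- r) wint (F i).
Proof.
move=> bF; elim: r => [|i r IH].
  rewrite big_nil -[RHS](mul0r (wint (fun=> 0))) -wintZ; last exact: bounded_measurable_cst.
  by apply: eq_wint => x _; rewrite big_nil mulr0.
rewrite big_cons -IH -wintD//; last exact: bounded_measurable_sum.
by apply: eq_wint => x _ /=; rewrite big_cons.
Qed.

Lemma wint_ge0 f : (forall x, Omega x -> 0 <= f x) -> 0 <= wint f.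
Proof.
move=> f0; apply: Rintegral_ge0 => x Ox; rewrite mulr_ge0 ?f0//.
by rewrite ltW// weight_gt0// -OmegaE.
Qed.

Lemma le_wint f g : bounded_measurable f -> bounded_measurable g ->
  (forall x, Omega x -> f x <= g x) -> wint f <= wint g.
Proof.
move=> bf bg fg; rewrite -subr_ge0 -wintB//; apply: wint_ge0 => x Ox.
by rewrite subr_ge0 fg.
Qed.

Lemma wint_norm f : bounded_measurable f -> `|wint f| <= wint (Num.norm \o f).
Proof.
move=> bf; apply: le_trans (le_normr_Rintegral _ _) _.
- exact: measurable_Omega.
- exact: bounded_measurable_weight.
rewrite le_eqVlt; apply/orP; left; apply/eqP/eq_Rintegral => x.
by rewrite inE OmegaE => x1; rewrite normrM (gtr0_norm (weight_gt0 x1)).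
Qed.

Lemma sin_natpi n : sin (n%:R * pi) = 0 :> R.
Proof.
elim: n => [|n IH]; first by rewrite mul0r sin0.
by rewrite -natr1 mulrDl mul1r sinDpi IH oppr0.
Qed.

Lemma chebyshevSN1 n : chebyshevS n (-1) = 0 :> R.
Proof. by rewrite /chebyshevS acosN1 sin_natpi mul0r. Qed.

Lemma chebyshevS1 n : chebyshevS n 1 = 0 :> R.
Proof. by rewrite /chebyshevS acos1 mulr0 sin0 mul0r. Qed.

Lemma chebyshevT_weight_integrable n :
  mu.-integrable (Omega : set R) (EFin \o (chebyshevT n \* weight)).
Proof. apply: bounded_measurable_weight; exact: bounded_measurable_chebyshevT. Qed.

Lemma continuous_chebyshevT_weight n x : -1 < x < 1 ->
  {for x, continuous (chebyshevT n \* weight)}.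
Proof.
by move=> x1; apply: continuousM; [exact: continuous_chebyshevT|exact: continuous_weight].
Qed.

Lemma Rintegral_chebyshevT_left n x : (0 < n)%N -> -1 <= x <= 1 ->
  \int[mu]_(y in `]-1, x[) (chebyshevT n y * weight y) = - chebyshevS n x.
Proof.
move=> n0 x1.
apply: etrans (@Rintegral_left (\- chebyshevS n) (chebyshevT n \* weight) _ _ _ _ x x1) _.
- by move=> y; apply: continuousN; exact: within_continuous_chebyshevS.
- move=> y y1; rewrite -[(_ \* _) y]opprK; have ? := is_derive_chebyshevS n0 y1.
  exact: is_deriveN.
- by move=> y; exact: continuous_chebyshevT_weight.
- exact: chebyshevT_weight_integrable.
- by rewrite /= chebyshevSN1 oppr0 subr0.
Qed.

Lemma Rintegral_chebyshevT_right n x : (0 < n)%N -> -1 < x < 1 ->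
  \int[mu]_(y in `]x, 1[) (chebyshevT n y * weight y) = chebyshevS n x.
Proof.
move=> n0 x1.
apply: etrans (@Rintegral_right (\- chebyshevS n) (chebyshevT n \* weight) _ _ _ _ x x1) _.
- by move=> y; apply: continuousN; exact: within_continuous_chebyshevS.
- move=> y y1; rewrite -[(_ \* _) y]opprK; have ? := is_derive_chebyshevS n0 y1.
  exact: is_deriveN.
- by move=> y; exact: continuous_chebyshevT_weight.
- exact: chebyshevT_weight_integrable.
- by rewrite /= chebyshevS1 oppr0 sub0r opprK.
Qed.

Lemma chebyshevT0 x : chebyshevT 0 x = 1.
Proof. by rewrite /chebyshevT mul0r cos0. Qed.

Lemma wint_cst c : wint (fun=> c) = c * pi.
Proof.
rewrite -[c in LHS]mulr1 wintZ; last exact: bounded_measurable_cst.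
congr (_ * _); rewrite /wint.
under eq_Rintegral do rewrite mul1r.
have le11 : -1 <= (1 : R) <= 1 by rewrite lexx; lra.
apply: etrans (@Rintegral_left (\- acos) weight _ _ _ _ 1 le11) _.
- by move=> y; apply: continuousN; exact: within_continuous_acos.
- move=> y y1; rewrite -[weight y]opprK; have ? := is_derive_acos y1.
  exact: is_deriveN.
- by move=> y; exact: continuous_weight.
- exact: weight_integrable.
- by rewrite /= acos1 acosN1; lra.
Qed.

Lemma wint_chebyshevT n : (0 < n)%N -> wint (chebyshevT n) = 0.
Proof.
move=> n0; rewrite /wint /Omega Rintegral_chebyshevT_left//; last by rewrite lexx; lra.
by rewrite chebyshevS1 oppr0.
Qed.

Lemma chebyshevT_mul n m x : (m <= n)%N ->
  chebyshevT n x * chebyshevT m x = 2^-1 * (chebyshevT (n + m) x + chebyshevT (n - m) x).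
Proof.
by move=> mn; rewrite /chebyshevT natrD natrB// mulrDl mulrBl cosD cosB; lra.
Qed.

(** Products of Chebyshev polynomials linearize, [2 T_n T_m = T_(n+m) + T_(n-m)],
and only [T_0] has a nonzero mean. *)
Lemma wint_chebyshevT_mul n m : (0 < n)%N ->
  wint (chebyshevT n \* chebyshevT m) = if n == m then pi / 2 else 0.
Proof.
have bT k := @bounded_measurable_chebyshevT R k.
have H k l : (l <= k)%N -> (0 < k)%N ->
    wint (chebyshevT k \* chebyshevT l) = 2^-1 * wint (chebyshevT (k - l)).
  move=> lk k0.
  rewrite (eq_wint (g := fun x => 2^-1 * (chebyshevT (k + l) \+ chebyshevT (k - l)) x)).
    rewrite wintZ; last exact: bounded_measurableD.
    by rewrite wintD// wint_chebyshevT ?add0r// addn_gt0 k0.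
  by move=> x _; rewrite /= chebyshevT_mul.
move=> n0; have [nm|mn|<-] := ltngtP n m.
- rewrite (eq_wint (g := chebyshevT m \* chebyshevT n)) ?H ?(ltnW nm)//; last 2 first.
    exact: ltn_trans n0 nm.
    by move=> x _; rewrite /= mulrC.
  by rewrite wint_chebyshevT ?mulr0// subn_gt0.
- by rewrite H ?(ltnW mn)// wint_chebyshevT ?mulr0// subn_gt0.
- rewrite H// subnn (eq_wint (g := fun=> 1)) ?wint_cst; first by lra.
  by move=> x _; exact: chebyshevT0.
Qed.

Lemma chebyshev_coefE f n : chebyshev_coef f n = 2 / pi * wint (f \* chebyshevT n).
Proof.
by congr (_ * _); apply: eq_Rintegral => x _; rewrite /= -mulrA.
Qed.

End chebyshev_integrals.

(** * Partial sums: the Christoffel-Darboux formula and Bessel's inequality *)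

Section chebyshev_series.
Context {R : realType}.
Notation mu := (@lebesgue_measure R).
Implicit Types (f g q : R -> R) (x y : R) (n m N : nat).

Lemma chebyshevT_rec n x : -1 <= x <= 1 ->
  chebyshevT n.+2 x = 2 * x * chebyshevT n.+1 x - chebyshevT n x.
Proof.
move=> x1; have E : cos (acos x) = x by rewrite acosK// in_itv.
have := @chebyshevT_mul R n.+1 1 x isT.
rewrite addn1 subn1/= {2}/chebyshevT mul1r E => H.
lra.
Qed.

Lemma chebyshevT1 x : -1 <= x <= 1 -> chebyshevT 1 x = x.
Proof. by move=> x1; rewrite /chebyshevT mul1r acosK// in_itv. Qed.

(** The partial sum of order [N] at [x] is the mean of [f] against [2 / pi] times
this kernel. In the variables [acos x] and [acos y] it is the average of two
halved Dirichlet kernels, at the sum and at the difference. *)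
Definition chebyshev_kernel N x y : R :=
  2^-1 + \sum_(1 <= n < N.+1) chebyshevT n x * chebyshevT n y.

(** The Christoffel-Darboux formula, by induction with the three-term recurrence. *)
Lemma christoffel_darboux N x y : -1 <= x <= 1 -> -1 <= y <= 1 ->
  2 * ((x - y) * chebyshev_kernel N x y) =
  chebyshevT N.+1 x * chebyshevT N y - chebyshevT N x * chebyshevT N.+1 y.
Proof.
move=> x1 y1; elim: N => [|N IH].
  by rewrite /chebyshev_kernel big_geq// !chebyshevT0 !chebyshevT1//; lra.
have -> : chebyshev_kernel N.+1 x y = chebyshev_kernel N x y + chebyshevT N.+1 x * chebyshevT N.+1 y.
  by rewrite /chebyshev_kernel big_nat_recr//= addrA.
by rewrite mulrDr mulrDr IH !chebyshevT_rec//; lra.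
Qed.

Lemma bounded_measurable_kernel N x : bounded_measurable (chebyshev_kernel N x).
Proof.
apply: bounded_measurableD; first exact: bounded_measurable_cst.
apply: bounded_measurable_sum => n.
by apply: bounded_measurableZ; exact: bounded_measurable_chebyshevT.
Qed.

Lemma chebyshev_sumE N f x : bounded_measurable f ->
  chebyshev_sum N f x = 2 / pi * wint (f \* chebyshev_kernel N x).
Proof.
move=> bf; have bT n := @bounded_measurable_chebyshevT R n.
have bfT n := bounded_measurableM bf (bT n).
rewrite (eq_wint (g := (fun y => 2^-1 * f y) \+
  (fun y => \sum_(1 <= n < N.+1) chebyshevT n x * (f y * chebyshevT n y)))); last first.
  move=> y _ /=; rewrite /chebyshev_kernel mulrDr mulrC; congr (_ + _).
  by rewrite mulr_sumr; apply: eq_bigr => n _; rewrite mulrCA.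
rewrite wintD; last 2 first.
  exact: bounded_measurableZ.
  by apply: bounded_measurable_sum => n; exact: bounded_measurableZ (bfT n).
rewrite wintZ// wint_sum; last by move=> n; exact: bounded_measurableZ (bfT n).
rewrite /chebyshev_sum chebyshevT0 mulr1 mulrDr mulr_sumr; congr (_ + _).
  rewrite chebyshev_coefE (eq_wint (g := f)); first by lra.
  by move=> y _; rewrite /= chebyshevT0 mulr1.
apply: eq_bigr => n _; rewrite chebyshev_coefE (wintZ _ (bfT n)).
by rewrite mulrCA mulrC.
Qed.

Lemma wint_kernel N x : wint (chebyshev_kernel N x) = pi / 2.
Proof.
have bT n := @bounded_measurable_chebyshevT R n.
rewrite wintD; last 2 first.
  exact: bounded_measurable_cst.
  by apply: bounded_measurable_sum => n; exact: bounded_measurableZ.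
rewrite wint_cst wint_sum; last by move=> n; exact: bounded_measurableZ.
rewrite big_nat_cond big1 ?addr0; first by lra.
move=> n; rewrite andbT => /andP[n0 _].
by rewrite wintZ// wint_chebyshevT ?mulr0.
Qed.

(** The kernel has total mass one, so the error is a mean of increments of [f]. *)
Lemma chebyshev_errorE N f x : bounded_measurable f ->
  f x - chebyshev_sum N f x = 2 / pi * wint ((fun y => f x - f y) \* chebyshev_kernel N x).
Proof.
move=> bf; have bk := bounded_measurable_kernel N x.
rewrite chebyshev_sumE//.
rewrite (eq_wint (f := (fun y => f x - f y) \* chebyshev_kernel N x)
  (g := (fun y => f x * chebyshev_kernel N x y) \- (f \* chebyshev_kernel N x))); last first.
  by move=> y _ /=; rewrite mulrBl.
rewrite wintB; [|exact: bounded_measurableZ|exact: bounded_measurableM].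
rewrite wintZ// wint_kernel mulrBr; congr (_ - _).
have := @pi_gt0 R; move=> /lt0r_neq0 pi0.
by rewrite mulrCA -[2 / pi * _]/(_ * (_ / _)) mulrA divfK// divff ?mulr1// pnatr_eq0.
Qed.

Section bessel.
Variable q : R -> R.
Hypothesis bq : bounded_measurable q.

Let rest N x : R := q x - \sum_(1 <= n < N.+1) chebyshev_coef q n * chebyshevT n x.

Let brest N : bounded_measurable (rest N).
Proof.
apply: bounded_measurableB => //; apply: bounded_measurable_sum => n.
by apply: bounded_measurableZ; exact: bounded_measurable_chebyshevT.
Qed.

Let wint_rest N m : (N < m)%N ->
  wint (rest N \* chebyshevT m) = pi / 2 * chebyshev_coef q m.
Proof.
move=> Nm; have bT n := @bounded_measurable_chebyshevT R n.
rewrite (eq_wint (g := (q \* chebyshevT m) \- (fun x => \sum_(1 <= n < N.+1)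
  chebyshev_coef q n * (chebyshevT n \* chebyshevT m) x))); last first.
  move=> x _; rewrite /rest /= mulrBl mulr_suml; congr (_ - _).
  by apply: eq_bigr => n _; rewrite mulrA.
rewrite wintB; last 2 first.
  exact: bounded_measurableM.
  by apply: bounded_measurable_sum => n; apply: bounded_measurableZ; exact: bounded_measurableM.
rewrite wint_sum; last by move=> n; apply: bounded_measurableZ; exact: bounded_measurableM.
rewrite big_nat_cond big1 ?subr0.
  rewrite chebyshev_coefE mulrA; have := @pi_gt0 R => /lt0r_neq0 pi0.
  by rewrite -[pi / 2]invf_div mulVf ?mul1r// mulf_neq0 ?invr_eq0// pnatr_eq0.
move=> n; rewrite andbT => /andP[n0 nN].
rewrite wintZ; last exact: bounded_measurableM.
rewrite wint_chebyshevT_mul// ltn_eqF ?mulr0//.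
exact: leq_trans nN Nm.
Qed.

(** Bessel's inequality: by orthogonality the left side is subtracted from the
square mean of [q] when passing to the square mean of the remainder. *)
Lemma bessel_inequality N : \sum_(1 <= n < N.+1) chebyshev_coef q n ^+ 2 <=
  2 / pi * wint (q \* q).
Proof.
have bT n := @bounded_measurable_chebyshevT R n.
have H : wint (rest N \* rest N) = wint (q \* q) -
    pi / 2 * \sum_(1 <= n < N.+1) chebyshev_coef q n ^+ 2.
  elim: N => [|N IH].
    rewrite [in RHS]big_geq// mulr0 subr0; apply: eq_wint => x _.
    by rewrite /rest /= big_geq// subr0.
  rewrite big_nat_recr//= mulrDr opprD addrA -IH.
  set c := chebyshev_coef q N.+1.
  rewrite (eq_wint (g := (rest N \* rest N) \+ ((fun x => (- (2 * c)) *
    (rest N \* chebyshevT N.+1) x) \+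
    (fun x => c ^+ 2 * (chebyshevT N.+1 \* chebyshevT N.+1) x)))); last first.
    by move=> x _; rewrite /rest /= big_nat_recr//= -/c; lra.
  have b1 := bounded_measurableM (brest N) (brest N).
  have b2 := bounded_measurableM (brest N) (bT N.+1).
  have b3 := bounded_measurableM (bT N.+1) (bT N.+1).
  rewrite wintD//; last by apply: bounded_measurableD; exact: bounded_measurableZ.
  rewrite wintD; [|exact: bounded_measurableZ..].
  rewrite !wintZ// wint_rest// -/c wint_chebyshevT_mul// eqxx; lra.
have := wint_ge0 (f := rest N \* rest N) (fun x _ => sqr_ge0 (rest N x)).
rewrite H; have := @pi_gt0 R => pi0.
rewrite -[2 / pi]invf_div => H0; rewrite [leRHS]mulrC ler_pdivlMr ?divr_gt0//; lra.
Qed.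

Lemma chebyshev_coef_cvg0 : chebyshev_coef q n @[n --> \oo] --> (0 : R).
Proof.
have cvg2 : (chebyshev_coef q n.+1) ^+ 2 @[n --> \oo] --> (0 : R).
  apply: cvg_series_cvg_0; apply: nondecreasing_is_cvgn.
    by apply: nondecreasing_series => n _ _; exact: sqr_ge0.
  exists (2 / pi * wint (q \* q)) => _ [N _ <-].
  by have := bessel_inequality N; rewrite big_add1.
apply/cvgrPdist_lt => e e0.
have e2 : 0 < e ^+ 2 by rewrite exprn_gt0.
move/cvgrPdist_lt : cvg2 => /(_ _ e2) [K _ KP].
exists K.+1 => // -[//|n] /= Kn; have := KP n Kn; rewrite /= !sub0r !normrN normrX.
by rewrite ltr_pXn2r// nnegrE// ltW.
Qed.

End bessel.

End chebyshev_series.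

(** * Convergence for Lipschitz functions *)

Section lipschitz.
Context {R : realType}.
Notation mu := (@lebesgue_measure R).
Implicit Types (f g q : R -> R) (x y : R) (n m N : nat).

(** The quotient is continuous off [x]; at [x] it takes the value [0]. *)
Lemma bounded_measurable_quotient f x L : bounded_measurable f ->
  {in (Omega : set R), continuous f} -> Omega x ->
  (forall y, Omega y -> `|f x - f y| <= L * `|x - y|) ->
  bounded_measurable (fun y => (f x - f y) / (x - y)).
Proof.
move=> bf cf Ox Lf; split.
  apply: (@measurable_funS _ _ _ _
    ((Omega `\ x) `|` [set x] : set (measurableTypeR R))).
  - apply: measurableU; last exact: measurable_set1.
    by apply: measurableD; [exact: measurable_Omega|exact: measurable_set1].
  - by move=> y Oy; have [->|/eqP yx] := eqVneq y x; [right|left].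
  apply/measurable_funU.
  - by apply: measurableD; [exact: measurable_Omega|exact: measurable_set1].
  - exact: measurable_set1.
  split; last exact: measurable_fun_set1.
  apply: open_continuous_measurable_fun.
    rewrite setDE; apply: openI; first exact: interval_open.
    by rewrite openC; exact: closed_eq.
  move=> y; rewrite inE => -[Oy /eqP yx].
  apply: (@cvgM R _ (nbhs y) _ (fun y => f x - f y) (fun y => (x - y)^-1)).
    by apply: cvgB; [exact: cvg_cst|apply: cf; rewrite inE].
  apply: cvgV; first by rewrite subr_eq0 eq_sym.
  by apply: cvgB; [exact: cvg_cst|exact: cvg_id].
exists `|L| => y Oy; have [->|yx] := eqVneq x y.
  by rewrite !subrr mul0r normr0.
rewrite normrM normfV ler_pdivrMr ?normr_gt0 ?subr_eq0//.
by apply: le_trans (Lf _ Oy) _; apply: ler_wpM2r => //; exact: ler_norm.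
Qed.

(** By the Christoffel-Darboux formula, the denominator of the difference quotient
at [x] turns the kernel into a combination of [T_N] and [T_(N+1)]. *)
Lemma chebyshev_error_quotient N f x L : bounded_measurable f ->
  {in (Omega : set R), continuous f} -> Omega x ->
  (forall y, Omega y -> `|f x - f y| <= L * `|x - y|) ->
  let q y := (f x - f y) / (x - y) in
  f x - chebyshev_sum N f x = 2^-1 * (chebyshevT N.+1 x * chebyshev_coef q N
     - chebyshevT N x * chebyshev_coef q N.+1).
Proof.
move=> bf cf Ox Lf q; have bq := bounded_measurable_quotient bf cf Ox Lf.
have bT n := @bounded_measurable_chebyshevT R n.
have x1 : -1 <= x <= 1 by move: Ox; rewrite OmegaE; lra.
rewrite chebyshev_errorE//.
rewrite (eq_wint (g := fun y => 2^-1 * ((fun y => chebyshevT N.+1 x * (q \* chebyshevT N) y)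
  \- (fun y => chebyshevT N x * (q \* chebyshevT N.+1) y)) y)); last first.
  move=> y; rewrite OmegaE => y1 /=.
  have [xy|xy] := eqVneq x y.
    by rewrite /q -xy !subrr !mul0r !mulr0 subrr mulr0.
  have /eqP : (f x - f y) = q y * (x - y) by rewrite /q divfK// subr_eq0.
  have := @christoffel_darboux R N x y x1 ltac:(lra).
  by move=> /(congr1 ( *%R (q y))) CD /eqP ->; lra.
have b1 n := bounded_measurableM bq (bT n).
have b2 c n := bounded_measurableZ c (b1 n).
rewrite (wintZ _ (bounded_measurableB (b2 _ _) (b2 _ _))) (wintB (b2 _ _) (b2 _ _)).
by rewrite (wintZ _ (b1 N)) (wintZ _ (b1 N.+1)) !chebyshev_coefE; lra.
Qed.

(** The coefficients of a bounded function tend to [0], by Bessel's inequality. *)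
Lemma chebyshev_sum_cvg f x L : bounded_measurable f ->
  {in (Omega : set R), continuous f} -> Omega x ->
  (forall y, Omega y -> `|f x - f y| <= L * `|x - y|) ->
  chebyshev_sum N f x @[N --> \oo] --> f x.
Proof.
move=> bf cf Ox Lf; pose q y := (f x - f y) / (x - y).
have bq : bounded_measurable q := bounded_measurable_quotient bf cf Ox Lf.
have /cvgrPdist_lt q0 := chebyshev_coef_cvg0 bq.
apply/cvgrPdist_lt => e e0; have [K _ KP] := q0 _ e0.
exists K => // n /= Kn.
rewrite (chebyshev_error_quotient _ bf cf Ox Lf) -/q.
have := KP n Kn; have := KP n.+1 (leqW Kn); rewrite /= !sub0r !normrN => h1 h2.
rewrite normrM gtr0_norm; last by lra.
have H m k : `|chebyshevT m x * chebyshev_coef q k| <= `|chebyshev_coef q k|.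
  by rewrite normrM ler_piMl// chebyshevT_max.
have := ler_normB (chebyshevT n.+1 x * chebyshev_coef q n)
   (chebyshevT n x * chebyshev_coef q n.+1).
have := H n.+1 n; have := H n n.+1; lra.
Qed.

(** The partial sums converge to [f x], and every [T_n x] is at most one in
absolute value. *)
Lemma chebyshev_error_tail f x L N B : bounded_measurable f ->
  {in (Omega : set R), continuous f} -> Omega x ->
  (forall y, Omega y -> `|f x - f y| <= L * `|x - y|) ->
  (forall M, (N <= M)%N -> \sum_(N.+1 <= n < M.+1) `|chebyshev_coef f n| <= B) ->
  `|f x - chebyshev_sum N f x| <= B.
Proof.
move=> bf cf Ox Lf HB; apply/ler_addgt0Pr => e e0.
have /cvgrPdist_lt /(_ _ e0) [K _ KP] := chebyshev_sum_cvg bf cf Ox Lf.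
pose M := maxn K N.
have {KP} h1 := KP M (leq_maxl _ _).
have NM : (N <= M)%N := leq_maxr _ _.
apply: le_trans (ler_distD (chebyshev_sum M f x) _ _) _.
rewrite [leRHS]addrC; apply: lerD; first exact: ltW.
apply: le_trans (HB _ NM).
rewrite /chebyshev_sum (big_cat_nat (n := N.+1) (p := M.+1))//=.
rewrite [X in `|X|](_ : _ = \sum_(N.+1 <= n < M.+1) chebyshev_coef f n * chebyshevT n x);
  last by lra.
apply: le_trans (ler_norm_sum _ _ _) _; apply: ler_sum => n _.
by rewrite normrM ler_piMr// chebyshevT_max.
Qed.

End lipschitz.

(** * Pairing with a function of bounded variation *)

Section layer_cake.
Context {R : realType}.
Notation mu := (@lebesgue_measure R).
Implicit Types (f g h w v : R -> R) (x y c p C : R) (n m N : nat).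

Lemma count_le_bounds (t : R) n : 0 <= t -> t <= n%:R ->
  t - 1 <= \sum_(1 <= j < n.+1) (j%:R <= t)%R%:R <= t.
Proof.
move=> t0 tn; have H k : \sum_(1 <= j < k.+1) (j%:R <= t)%R%:R =
    (if k%:R <= t then k%:R else \sum_(1 <= j < k) (j%:R <= t)%R%:R) :> R.
  elim: k => [|k IH]; first by rewrite t0 big_geq.
  rewrite big_nat_recr//=; case: ifPn => kt; last by rewrite addr0.
  rewrite IH ifT; last by apply: le_trans kt; rewrite ler_nat.
  by rewrite natr1.
elim: n tn => [|n IH] tn.
  by rewrite big_geq//; lra.
rewrite H; case: ifPn => nt; first by rewrite nt andbT; lra.
have [tn'|/ltW nt'] := leP t n%:R; first exact: IH.
rewrite H nt' nt' andbT; move: nt; rewrite -ltNge -natr1; lra.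
Qed.

Lemma Rintegral_sum (I : Type) (r : seq I) (D : set (measurableTypeR R))
    (F : I -> R -> R) : measurable D ->
  (forall i, mu.-integrable D (EFin \o F i)) ->
  mu.-integrable D (EFin \o (fun x => \sum_(i <- r) F i x)) /\
  \int[mu]_(x in D) (\sum_(i <- r) F i x) = \sum_(i <- r) \int[mu]_(x in D) F i x.
Proof.
move=> mD iF; elim: r => [|i r [IH1 IH2]].
  rewrite big_nil; have -> : (fun x => \sum_(i <- [::]) F i x) = (fun=> 0 : R).
    by apply/funext => x; rewrite big_nil.
  split; first exact: integrable0.
  by rewrite Rintegral_cst// mul0r.
have E : (fun x => \sum_(i <- i :: r) F i x) = F i \+ (fun x => \sum_(i <- r) F i x).
  by apply/funext => x; rewrite big_cons.
rewrite E; split; last by rewrite RintegralD// IH2 big_cons.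
by have := integrableD mD (iF i) IH1; apply: eq_integrable.
Qed.

(** Layer cake bound: a nonnegative function at most [p] is within [p / n] of
[p / n] times the number of levels [j * p / n], [1 <= j <= n], that it reaches. *)
Lemma layer_cake_bound h w p C : measurable_fun (Omega : set (measurableTypeR R)) h ->
  (forall x, Omega x -> 0 <= h x <= p) ->
  mu.-integrable (Omega : set R) (EFin \o w) ->
  (forall s, 0 < s ->
     `|\int[mu]_(x in Omega `&` [set x | s <= h x]) w x| <= C) ->
  `|\int[mu]_(x in Omega) (h x * w x)| <= p * C.
Proof.
move=> mh hp iw HC; have mO := @measurable_Omega R.
have p0 : 0 <= p.
  have := hp 0; rewrite OmegaE => /(_ ltac:(lra)) /andP[]; exact: le_trans.
have C0 : 0 <= C by apply: le_trans (HC 1 _).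
have ihw : mu.-integrable (Omega : set R) (EFin \o (h \* w)).
  apply: bounded_measurable_integrable => //; split => //; exists p => x Ox.
  by have /andP[h0 hle] := hp x Ox; rewrite ger0_norm.
move: p0; rewrite le_eqVlt => /predU1P[pE|p0].
  rewrite -pE mul0r (@eq_Rintegral _ _ _ mu Omega (fun=> 0)) ?Rintegral_cst// ?mul0r ?normr0//.
  move=> x; rewrite inE => /hp; rewrite -pE -eq_le => /eqP <-.
  by rewrite mul0r.
set K := \int[mu]_(x in Omega) `|w x|.
have iaw : mu.-integrable (Omega : set R) (EFin \o (fun x => `|w x|)).
  exact: integrable_norm.
have K0 : 0 <= K by apply: Rintegral_ge0.
apply/ler_addgt0Pr => e e0.
(* Fine enough for the discretization error [p / n * K] to be at most [e]. *)
pose n := (Num.truncn (p * K / e)).+1.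
have n0 : 0 < n%:R :> R by rewrite ltr0n.
have pKn : p / n%:R * K <= e.
  have := truncnS_gt (p * K / e); rewrite -/n ltr_pdivrMr// => pKe.
  by rewrite mulrAC ler_pdivrMr// [leRHS]mulrC ltW.
pose s j : R := j%:R * (p / n%:R).
pose A j := [set x | s j <= h x].
have iA j : mu.-integrable (Omega : set R) (EFin \o (w \_ (A j))).
  have mA : measurable (Omega `&` A j : set (measurableTypeR R)).
    have -> : A j = h @^-1` `[s j, +oo[ by apply/seteqP; split => x /=; rewrite in_itv/= andbT.
    exact: mh.
  have iOA : mu.-integrable (Omega `&` A j) (EFin \o w) by apply: integrableS iw.
  have := integrable_patch mA iOA.
  move=> /(@integrableS _ _ _ _ _ _ _ measurableT mO (@subsetT _ _)).
  apply: eq_integrable => // x; rewrite inE => Ox /=.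
  rewrite /patch; congr (_%:E).
  by case: ifPn; rewrite ?inE ?notin_setE => h1; case: ifPn => //;
    rewrite ?inE ?notin_setE => h2; exfalso; [apply: h2; case: h1|apply: h1].
have [iS SE] := Rintegral_sum (index_iota 1 n.+1) mO iA.
pose hn x := \sum_(1 <= j < n.+1) (w \_ (A j)) x.
have iD : mu.-integrable (Omega : set R)
    (EFin \o (fun x => (p / n%:R) * hn x)).
  by have := integrableZl mO (p / n%:R) iS; apply: eq_integrable.
have hnE x : Omega x -> `|h x * w x - p / n%:R * hn x| <= p / n%:R * `|w x|.
  move=> /hp /andP[h0 hle].
  have -> : hn x = (\sum_(1 <= j < n.+1) (j%:R <= h x * (n%:R / p))%R%:R) * w x.
    rewrite mulr_suml; apply: eq_bigr => j _; rewrite /patch.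
    have -> : (x \in A j) = (j%:R <= h x * (n%:R / p)).
      rewrite /A /s; apply/idP/idP; rewrite inE/= -[n%:R / p]invf_div ler_pdivlMr ?divr_gt0//.
    by case: ifP => _; rewrite ?mul1r ?mul0r.
  have t0 : 0 <= h x * (n%:R / p) by rewrite mulr_ge0// divr_ge0// ltW.
  have tn : h x * (n%:R / p) <= n%:R.
    by rewrite mulrCA ler_piMr ?(ltW n0)// ler_pdivrMr// mul1r.
  have /andP[c1 c2] := count_le_bounds t0 tn.
  move: c1 c2; set cnt := \sum_(_ <= _ < _) _ => c1 c2.
  rewrite [X in `|X|](_ : _ = p / n%:R * ((h x * (n%:R / p) - cnt) * w x)); last first.
    rewrite mulrBl mulrBr; congr (_ - _).
    rewrite -[n%:R / p]invf_div [h x / _ * _]mulrAC [RHS]mulrC divfK//.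
    by rewrite gt_eqF// divr_gt0.
  rewrite normrM gtr0_norm ?divr_gt0// ler_pM2l ?divr_gt0// normrM ler_piMl//.
  by rewrite ler_norml; lra.
have -> : \int[mu]_(x in Omega) (h x * w x) =
   \int[mu]_(x in Omega) (h x * w x - p / n%:R * hn x) +
   p / n%:R * \sum_(1 <= j < n.+1) \int[mu]_(x in Omega) (w \_ (A j)) x.
  by rewrite RintegralB// -SE RintegralZl//; lra.
apply: le_trans (ler_normD _ _) _; rewrite addrC; apply: lerD.
  rewrite normrM gtr0_norm ?divr_gt0//.
  rewrite -[leLHS]mulrA ler_pM2l// ler_pdivrMl//.
  apply: le_trans (ler_norm_sum _ _ _) _.
  apply: (@le_trans _ _ (\sum_(1 <= j < n.+1) C)); last first.
    by rewrite sumr_const_nat subn1/= mulr_natl.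
  rewrite big_nat_cond [leRHS]big_nat_cond; apply: ler_sum => j /andP[/andP[j0 _] _].
  rewrite -Rintegral_mkcondr; apply: HC.
  by rewrite /s mulr_gt0 ?divr_gt0// ltr0n.
apply: le_trans pKn; apply: le_trans (le_normr_Rintegral _ _) _ => //.
  by have := integrableB mO ihw iD; apply: eq_integrable.
rewrite -RintegralZl//; apply: le_Rintegral => //.
  have : mu.-integrable (Omega : set R) (EFin \o (fun x => h x * w x - p / n%:R * hn x)).
    by have := integrableB mO ihw iD; apply: eq_integrable.
  by move=> /integrable_norm.
by have := integrableZl mO (p / n%:R) iaw; apply: eq_integrable.
Qed.

End layer_cake.

Section bounded_variation_pairing.
Context {R : realType}.
Notation mu := (@lebesgue_measure R).
Implicit Types (f g h w v : R -> R) (x y c p C V : R) (n m N : nat).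

Lemma interval_oo_measurable f : {in (Omega : set R) &, nondecreasing_fun f} ->
  measurable_fun (Omega : set (measurableTypeR R)) f.
Proof.
move=> ndf; apply: (measurability (@RGenCInfty.G R)) => [|/= _ [_] [r] -> <-].
  exact: RGenCInfty.measurableE.
apply: is_interval_measurable => s t/=.
rewrite /Omega/= !in_itv/= !andbT => -[s1 fs] [t1 _] u /andP[su ut].
have u1 : -1 < u < 1 by lra.
split; first by rewrite in_itv.
by rewrite in_itv/= andbT (le_trans fs)// ndf// inE OmegaE.
Qed.

(** An up-closed subset of the interval is [ ]t, 1[ ] or [ [t, 1[ ], with [t] its
infimum. *)
Lemma Rintegral_upset U c w C : U `<=` Omega ->
  mu.-integrable (Omega : set R) (EFin \o w) ->
  (forall x, U x -> c < x) -> Omega c ->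
  (forall x y, U x -> x <= y -> y < 1 -> U y) ->
  (forall y, Omega y -> c <= y -> `|\int[mu]_(x in `]y, 1[) w x| <= C) ->
  `|\int[mu]_(x in U) w x| <= C.
Proof.
move=> UO iw Uc Oc Uup HC.
have [->|/set0P[z Uz]] := eqVneq U set0.
  by rewrite Rintegral_set0 normr0 (le_trans _ (HC c _ _)).
have lbU : has_lbound U by exists c => x /Uc /ltW.
pose t := inf U.
have ct : c <= t by apply: lb_le_inf; [exists z|move=> x /Uc /ltW].
have tz : t <= z by exact: (ge_inf lbU).
have Ot : Omega t by move: Oc (UO _ Uz); rewrite !OmegaE; lra.
have iwt : mu.-integrable `]t, 1[ (EFin \o w).
  apply: integrableS iw; [exact: measurable_itv..|].
  by move=> x; move: Ot; rewrite /Omega /= !in_itv/=; lra.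
have Ut x : t < x -> x < 1 -> U x.
  move=> tx x1; have [y Uy yx] := inf_lt (ex_intro U z Uz) tx.
  exact: Uup Uy (ltW yx) x1.
have [Uint|Unt] := pselect (U t).
  have -> : U = `[t, 1[%classic.
    apply/seteqP; split => x; rewrite /= in_itv/=.
      move=> Ux; have -> : t <= x by exact: (ge_inf lbU).
      by move: (UO _ Ux); rewrite OmegaE; lra.
    by rewrite le_eqVlt => /andP[/predU1P[<-//|]]; exact: Ut.
  by rewrite -Rintegral_itv_obnd_cbnd//; exact: HC.
have -> : U = `]t, 1[%classic.
  apply/seteqP; split => x; rewrite /= in_itv/=.
    move=> Ux; have tx : t <= x by exact: (ge_inf lbU).
    have : x <> t by move=> xt; apply: Unt; rewrite -xt.
    move/eqP => xt; rewrite lt_neqAle eq_sym xt tx/=.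
    by move: (UO _ Ux); rewrite OmegaE; lra.
  by move=> /andP[]; exact: Ut.
exact: HC.
Qed.

Lemma Rintegral_downset U c w C : U `<=` Omega ->
  mu.-integrable (Omega : set R) (EFin \o w) ->
  (forall x, U x -> x < c) -> Omega c ->
  (forall x y, U x -> y <= x -> -1 < y -> U y) ->
  (forall y, Omega y -> y <= c -> `|\int[mu]_(x in `]-1, y[) w x| <= C) ->
  `|\int[mu]_(x in U) w x| <= C.
Proof.
move=> UO iw Uc Oc Udown HC.
have [->|/set0P[z Uz]] := eqVneq U set0.
  by rewrite Rintegral_set0 normr0 (le_trans _ (HC c _ _)).
have sU : has_sup U by split; [exists z|exists c => x /Uc /ltW].
pose t := sup U.
have ubt x : U x -> x <= t by move=> Ux; exact: (sup_upper_bound sU).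
have tc : t <= c by apply: ge_sup; [exists z|move=> x /Uc /ltW].
have Ot : Omega t by move: Oc (UO _ Uz) (ubt _ Uz); rewrite !OmegaE; lra.
have iwt : mu.-integrable `]-1, t[ (EFin \o w).
  apply: integrableS iw; [exact: measurable_itv..|].
  by move=> x; move: Ot; rewrite /Omega /= !in_itv/=; lra.
have Ut x : -1 < x -> x < t -> U x.
  move=> x1 tx; have [|y Uy yx] := @sup_adherent _ U (t - x) _ sU; first by lra.
  by apply: Udown Uy _ x1; rewrite -/t in yx; lra.
have [Uint|Unt] := pselect (U t).
  have -> : U = `]-1, t]%classic.
    apply/seteqP; split => x; rewrite /= in_itv/=.
      by move=> Ux; rewrite (ubt _ Ux) andbT; move: (UO _ Ux); rewrite OmegaE; lra.
    by rewrite le_eqVlt => /andP[x1 /predU1P[->//|]]; exact: Ut.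
  by rewrite -Rintegral_itv_bndo_bndc//; exact: HC.
have -> : U = `]-1, t[%classic.
  apply/seteqP; split => x; rewrite /= in_itv/=.
    move=> Ux; have tx := ubt _ Ux.
    have : x <> t by move=> xt; apply: Unt; rewrite -xt.
    move/eqP => xt; rewrite [x < t]lt_neqAle xt tx/= andbT.
    by move: (UO _ Ux); rewrite OmegaE; lra.
  by move=> /andP[]; exact: Ut.
exact: HC.
Qed.

(** The positive and the negative part of a monotone function vanishing at [c]
have level sets that are intervals reaching [1], resp. [-1], without crossing
[c]. *)
Lemma nondecreasing_pairing h w c p p' C :
  {in (Omega : set R) &, nondecreasing_fun h} -> Omega c -> h c = 0 ->
  (forall x, Omega x -> - p' <= h x <= p) ->
  mu.-integrable (Omega : set R) (EFin \o w) ->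
  (forall y, Omega y -> y <= c -> `|\int[mu]_(x in `]-1, y[) w x| <= C) ->
  (forall y, Omega y -> c <= y -> `|\int[mu]_(x in `]y, 1[) w x| <= C) ->
  `|\int[mu]_(x in Omega) (h x * w x)| <= (p + p') * C.
Proof.
move=> ndh Oc hc hpp iw HL HR; have mO := @measurable_Omega R.
have mh := interval_oo_measurable ndh.
pose h1 x := Num.max (h x) 0; pose h2 x := Num.max (- h x) 0.
have mh1 : measurable_fun (Omega : set (measurableTypeR R)) h1.
  by apply: measurable_maxr => //; exact: measurable_cst.
have mh2 : measurable_fun (Omega : set (measurableTypeR R)) h2.
  by apply: measurable_maxr; [exact: measurableT_comp|exact: measurable_cst].
have /andP[p'0 p0] := hpp c Oc; rewrite hc in p0 p'0.
have b1 x : Omega x -> 0 <= h1 x <= p.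
  by move=> /hpp /andP[_ ?]; rewrite /h1 le_max lexx orbT ge_max; lra.
have b2 x : Omega x -> 0 <= h2 x <= p'.
  by move=> /hpp /andP[? _]; rewrite /h2 le_max lexx orbT ge_max; lra.
have ihw (k : R -> R) (P : R) : measurable_fun (Omega : set (measurableTypeR R)) k ->
    (forall x, Omega x -> 0 <= k x <= P) ->
    mu.-integrable (Omega : set R) (EFin \o (k \* w)).
  move=> mk bk; apply: bounded_measurable_integrable => //; split => //.
  by exists P => x Ox; have /andP[h0 hle] := bk x Ox; rewrite ger0_norm.
have -> : \int[mu]_(x in Omega) (h x * w x) =
    \int[mu]_(x in Omega) (h1 x * w x) - \int[mu]_(x in Omega) (h2 x * w x).
  rewrite -RintegralB//; [|exact: ihw mh1 b1|exact: ihw mh2 b2].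
  apply: eq_Rintegral => x _; rewrite -mulrBl; congr (_ * _).
  by rewrite /h1 /h2; case: (leP (h x) 0); case: (leP (- h x) 0); lra.
apply: le_trans (ler_normB _ _) _; rewrite mulrDl; apply: lerD.
  apply: layer_cake_bound => // s s0; apply: (Rintegral_upset (c := c)) => //.
  - move=> x [Ox /=]; rewrite /h1 le_max [s <= 0]leNgt s0 orbF => sx.
    rewrite ltNge; apply/negP => xc; have := ndh x c.
    by rewrite !inE => /(_ Ox Oc xc); rewrite hc; lra.
  - move=> x y [Ox /=]; rewrite /h1 !le_max [s <= 0]leNgt s0 !orbF => sx xy y1.
    have Oy : Omega y by move: Ox; rewrite !OmegaE; lra.
    by split; [exact: Oy|]; rewrite /= (le_trans sx)// ndh ?inE.
apply: layer_cake_bound => // s s0; apply: (Rintegral_downset (c := c)) => //.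
- move=> x [Ox /=]; rewrite /h2 le_max [s <= 0]leNgt s0 orbF => sx.
  rewrite ltNge; apply/negP => xc; have := ndh c x.
  by rewrite !inE => /(_ Oc Ox xc); rewrite hc; lra.
- move=> x y [Ox /=]; rewrite /h2 !le_max [s <= 0]leNgt s0 !orbF => sx xy y1.
  have Oy : Omega y by move: Ox; rewrite !OmegaE; lra.
  by split; [exact: Oy|]; rewrite /= (le_trans sx)// lerN2 ndh ?inE.
Qed.

Section jordan.
Variables (v : R -> R) (V : R).
Hypothesis TVv : (TV_Omega v <= V%:E)%E.

Lemma TV_Omega_le x y : Omega x -> Omega y -> x <= y ->
  (total_variation x y v <= V%:E)%E.
Proof.
rewrite !OmegaE => Ox Oy xy; apply: le_trans TVv.
by apply: ereal_sup_ubound; exists (x, y) => //=; lra.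
Qed.

Let tv x y : R := fine (total_variation x y v).

Let tv_fin x y : Omega x -> Omega y -> x <= y -> total_variation x y v \is a fin_num.
Proof.
move=> Ox Oy xy; rewrite ge0_fin_numE ?total_variation_ge0//.
by apply: le_lt_trans (TV_Omega_le Ox Oy xy) _; exact: ltry.
Qed.

Let tv_le x y : Omega x -> Omega y -> x <= y -> tv x y <= V.
Proof.
by move=> Ox Oy xy; rewrite -lee_fin fineK ?TV_Omega_le//; exact: tv_fin.
Qed.

Let tv_ge x y : Omega x -> Omega y -> x <= y -> `|v y - v x| <= tv x y.
Proof.
move=> Ox Oy xy; rewrite -lee_fin fineK ?total_variation_ge//; exact: tv_fin.
Qed.

Let tvD x y z : Omega x -> Omega z -> x <= y -> y <= z ->
  tv x z = tv x y + tv y z.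
Proof.
move=> Ox Oz xy yz; rewrite /tv (total_variationD v xy yz) fineD//; apply: tv_fin => //.
all: by move: Ox Oz; rewrite !OmegaE; lra.
Qed.

Lemma TV_Omega_osc x y : Omega x -> Omega y -> `|v x - v y| <= V.
Proof.
move=> Ox Oy; have [xy|/ltW yx] := leP x y.
  by rewrite distrC; exact: le_trans (tv_ge Ox Oy xy) (tv_le Ox Oy xy).
exact: le_trans (tv_ge Oy Ox yx) (tv_le Oy Ox yx).
Qed.

(* The signed variation from [c]; half its sum and half its difference with
   [v - v c] are the two terms of the Jordan decomposition. *)
Let stv c y := if c <= y then tv c y else - tv y c.

Let stvB c x y : Omega c -> Omega x -> Omega y -> x <= y ->
  stv c y - stv c x = tv x y.
Proof.
move=> Oc Ox Oy xy; rewrite /stv; case: (leP c x) => cx; case: (leP c y) => cy.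
- by rewrite (tvD Oc Oy cx xy); lra.
- by lra.
- by rewrite (tvD Ox Oy (ltW cx) cy); lra.
- by rewrite (tvD Ox Oc xy (ltW cy)); lra.
Qed.

Let pvar c y := (stv c y + (v y - v c)) / 2.
Let nvar c y := (stv c y - (v y - v c)) / 2.

Let pvar_nd c : Omega c -> {in (Omega : set R) &, nondecreasing_fun (pvar c)}.
Proof.
move=> Oc x y; rewrite !inE => Ox Oy xy; rewrite /pvar.
have := stvB Oc Ox Oy xy; have := tv_ge Ox Oy xy; rewrite ler_norml; lra.
Qed.

Let nvar_nd c : Omega c -> {in (Omega : set R) &, nondecreasing_fun (nvar c)}.
Proof.
move=> Oc x y; rewrite !inE => Ox Oy xy; rewrite /nvar.
have := stvB Oc Ox Oy xy; have := tv_ge Ox Oy xy; rewrite ler_norml; lra.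
Qed.

Lemma TV_Omega_bounded_measurable : bounded_measurable v.
Proof.
have O0 : Omega (0 : R) by rewrite OmegaE; lra.
split.
  have -> : v = ((pvar 0 \- nvar 0) \+ (fun=> v 0)).
    by apply/funext => x; rewrite /pvar /nvar/=; lra.
  apply: measurable_funD; last exact: measurable_cst.
  by apply: measurable_funB; apply: interval_oo_measurable; [exact: pvar_nd|exact: nvar_nd].
exists (`|v 0| + V) => x Ox; have := TV_Omega_osc Ox O0.
have := ler_normD (v x - v 0) (v 0); rewrite subrK; lra.
Qed.

(** The integral form of the bound by the variation: in [\int (v - v c) w] the
weight enters only through its integrals over intervals reaching an end point,
as integration by parts against the measure [dv] suggests. *)
Lemma bounded_variation_pairing w c C : Omega c ->
  mu.-integrable (Omega : set R) (EFin \o w) ->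
  (forall y, Omega y -> y <= c -> `|\int[mu]_(x in `]-1, y[) w x| <= C) ->
  (forall y, Omega y -> c <= y -> `|\int[mu]_(x in `]y, 1[) w x| <= C) ->
  `|\int[mu]_(x in Omega) ((v x - v c) * w x)| <= V * C.
Proof.
move=> Oc iw HL HR; have mO := @measurable_Omega R.
have C0 : 0 <= C by apply: le_trans (HL c Oc (lexx _)).
have V0 : 0 <= V by apply: le_trans (tv_le Oc Oc (lexx _)); apply: le_trans (tv_ge Oc Oc (lexx _)).
have stvc : stv c c = 0 by have := stvB Oc Oc Oc (lexx _); rewrite /stv lexx; lra.
have pc : pvar c c = 0 by rewrite /pvar stvc; lra.
have nc : nvar c c = 0 by rewrite /nvar stvc; lra.
pose P := sup (pvar c @` Omega); pose P' := sup ((fun x => - pvar c x) @` Omega).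
pose Q := sup (nvar c @` Omega); pose Q' := sup ((fun x => - nvar c x) @` Omega).
have bst x : Omega x -> `|stv c x| <= V.
  move=> Ox; rewrite /stv; case: (leP c x) => [cx|/ltW cx].
    by rewrite ger0_norm ?tv_le// (le_trans _ (tv_ge Oc Ox cx)).
  by rewrite normrN ger0_norm ?tv_le// (le_trans _ (tv_ge Ox Oc cx)).
have bv x : Omega x -> `|v x - v c| <= V by move=> Ox; exact: TV_Omega_osc.
have supP f : (forall x, Omega x -> f x <= V) -> forall x, Omega x -> f x <= sup (f @` Omega).
  move=> fV x Ox; apply: ub_le_sup; last by exists x.
  by exists V => _ [z Oz <-]; exact: fV.
have supB f B : (forall x, Omega x -> f x <= B) -> sup (f @` Omega) <= B.
  move=> fB; apply: ge_sup; first by exists (f c); exists c.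
  by move=> _ [z Oz <-]; exact: fB.
(* The extrema of the two monotone terms are attained together: replacing the
   four points by their extreme ones turns the sum into one variation. *)
have total : P + P' + (Q + Q') <= V.
  suff : P <= V - (P' + (Q + Q')) by lra.
  apply: (supB _ _) => x1 O1; suff : P' <= V - pvar c x1 - (Q + Q') by lra.
  apply: (supB _ _) => x2 O2; suff : Q <= V - pvar c x1 + pvar c x2 - Q' by lra.
  apply: (supB _ _) => x3 O3; suff : Q' <= V - pvar c x1 + pvar c x2 - nvar c x3 by lra.
  apply: (supB _ _) => x4 O4.
  have O (a b : R) : Omega a -> Omega b -> Omega (Num.max a b) /\ Omega (Num.min a b).
    by move=> Oa Ob; rewrite maxEle minEle; case: ifP.
  have [OM _] := O _ _ O1 O3; have [_ Om] := O _ _ O2 O4.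
  set M := Num.max x1 x3 in OM *; set m := Num.min x2 x4 in Om *.
  have i1 : x1 <= M by rewrite le_max lexx.
  have i3 : x3 <= M by rewrite le_max lexx orbT.
  have i2 : m <= x2 by rewrite ge_min lexx.
  have i4 : m <= x4 by rewrite ge_min lexx orbT.
  have := @pvar_nd c Oc x1 M; rewrite !inE => /(_ O1 OM i1).
  have := @nvar_nd c Oc x3 M; rewrite !inE => /(_ O3 OM i3).
  have := @pvar_nd c Oc m x2; rewrite !inE => /(_ Om O2 i2).
  have := @nvar_nd c Oc m x4; rewrite !inE => /(_ Om O4 i4).
  have : stv c M - stv c m <= V.
    have [mM|/ltW Mm] := leP m M; first by rewrite stvB// tv_le.
    have := stvB Oc OM Om Mm; have := tv_ge OM Om Mm.
    have := normr_ge0 (v m - v M); lra.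
  clear C0 V0 stvc pc nc i1 i2 i3 i4; rewrite /pvar /nvar; lra.
have iP : mu.-integrable (Omega : set R) (EFin \o (pvar c \* w)).
  apply: bounded_measurable_integrable => //; split.
    exact: interval_oo_measurable (pvar_nd Oc).
  exists V => x Ox; move: (bst x Ox) (bv x Ox); rewrite /pvar !ler_norml; lra.
have iN : mu.-integrable (Omega : set R) (EFin \o (nvar c \* w)).
  apply: bounded_measurable_integrable => //; split.
    exact: interval_oo_measurable (nvar_nd Oc).
  exists V => x Ox; move: (bst x Ox) (bv x Ox); rewrite /nvar !ler_norml; lra.
have -> : \int[mu]_(x in Omega) ((v x - v c) * w x) =
    \int[mu]_(x in Omega) (pvar c x * w x) - \int[mu]_(x in Omega) (nvar c x * w x).
  rewrite -RintegralB//; apply: eq_Rintegral => x _; rewrite -mulrBl; congr (_ * _).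
  by rewrite /pvar /nvar; lra.
apply: le_trans (ler_normB _ _) _.
apply: (@le_trans _ _ ((P + P') * C + (Q + Q') * C)); last first.
  by rewrite -mulrDl ler_wpM2r.
apply: lerD.
  apply: nondecreasing_pairing (pvar_nd Oc) Oc pc _ iw HL HR => x Ox.
  rewrite lerNl; apply/andP; split.
    apply: (supP (fun x => - pvar c x)) => // z Oz.
    by move: (bst z Oz) (bv z Oz); rewrite /pvar !ler_norml; lra.
  apply: (supP (pvar c)) => // z Oz.
  by move: (bst z Oz) (bv z Oz); rewrite /pvar !ler_norml; lra.
apply: nondecreasing_pairing (nvar_nd Oc) Oc nc _ iw HL HR => x Ox.
rewrite lerNl; apply/andP; split.
  apply: (supP (fun x => - nvar c x)) => // z Oz.
  by move: (bst z Oz) (bv z Oz); rewrite /nvar !ler_norml; lra.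
apply: (supP (nvar c)) => // z Oz.
by move: (bst z Oz) (bv z Oz); rewrite /nvar !ler_norml; lra.
Qed.

End jordan.

End bounded_variation_pairing.

(** * The remainder of the sawtooth series *)

Section sawtooth.
Context {R : realType}.
Implicit Types (s t x y : R) (n N : nat).

Definition sine_sum N s : R := \sum_(1 <= n < N.+1) sin (n%:R * s) / n%:R.

(** On [ ]0, 2 pi[ ], where the sawtooth [(pi - s) / 2] is the sum of all the
[sin (n s) / n], this is the sum of those of index greater than [N]. *)
Definition sawtooth_rest N s : R := (pi - s) / 2 - sine_sum N s.

(** Half of the Dirichlet kernel. *)
Definition dirichlet N s : R := 2^-1 + \sum_(1 <= n < N.+1) cos (n%:R * s).

Lemma dirichletE N s : 2 * sin (s / 2) * dirichlet N s = sin ((N%:R + 2^-1) * s).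
Proof.
elim: N => [|N IH].
  by rewrite /dirichlet big_geq// addr0 add0r [2^-1 * s]mulrC; lra.
have -> : dirichlet N.+1 s = dirichlet N s + cos (N.+1%:R * s).
  by rewrite /dirichlet big_nat_recr//= addrA.
rewrite mulrDr IH.
have -> : (N%:R + 2^-1) * s = N.+1%:R * s - s / 2 by rewrite -[N.+1%:R]natr1; lra.
have -> : (N.+1%:R + 2^-1) * s = N.+1%:R * s + s / 2 by lra.
by rewrite sinB sinD; lra.
Qed.

Lemma sine_sumN N s : sine_sum N (- s) = - sine_sum N s.
Proof.
by rewrite /sine_sum -sumrN; apply: eq_bigr => n _; rewrite mulrN sinN mulNr.
Qed.

Lemma is_derive_sine_sum N s :
  is_derive s (1 : R) (sine_sum N) (\sum_(1 <= n < N.+1) cos (n%:R * s)).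
Proof.
elim: N => [|N IH].
  have -> : sine_sum 0 = cst 0 by apply/funext => t; rewrite /sine_sum big_geq.
  by rewrite big_geq//; exact: is_derive_cst.
have -> : sine_sum N.+1 = sine_sum N \+ (fun t => sin (N.+1%:R * t) / N.+1%:R).
  by apply/funext => t; rewrite /sine_sum big_nat_recr.
rewrite big_nat_recr//=; apply: is_deriveD.
apply: is_derive_eq; rewrite /GRing.scale/=.
by rewrite !mulr0 add0r mulr1 mulrCA mulVf ?mulr1// pnatr_eq0.
Qed.

Lemma is_derive_sawtooth_rest N s :
  is_derive s (1 : R) (sawtooth_rest N) (- dirichlet N s).
Proof.
have ? := is_derive_sine_sum N s; rewrite /sawtooth_rest /dirichlet.
apply: is_derive_eq; rewrite /GRing.scale/=; lra.
Qed.

Lemma continuous_sawtooth_rest N : continuous (sawtooth_rest N).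
Proof.
move=> s; apply/differentiable_continuous/derivable1_diffP.
by have [] := is_derive_sawtooth_rest N s.
Qed.

(** Jordan's inequality: [sin t - 2 t / pi] increases up to [acos (2 / pi)], then
decreases, and vanishes at both [0] and [pi / 2]. *)
Lemma sin_half_ge s : 0 <= s <= pi -> s / pi <= sin (s / 2).
Proof.
move=> /andP[s0 spi]; have pi2 := @pi_ge2 R.
have pi0 : 0 < pi / 2 :> R by rewrite divr_gt0 ?pi_gt0.
pose f t : R := sin t - t * (2 / pi).
have df t : is_derive t (1 : R) f (cos t - 2 / pi).
  by rewrite /f; apply: is_derive_eq; rewrite /GRing.scale/=; lra.
have cf a b : {within `[a, b], continuous f}.
  apply: continuous_subspaceT => t; apply/differentiable_continuous/derivable1_diffP.
  by have [] := df t.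
have c1 : 0 < 2 / pi :> R by rewrite divr_gt0 ?pi_gt0.
have c2 : 2 / pi <= 1 :> R by rewrite ler_pdivrMr ?pi_gt0// mul1r.
pose t0 : R := acos (2 / pi).
have cost0 : cos t0 = 2 / pi by rewrite acosK// in_itv/=; lra.
have t00 : 0 <= t0 by apply: acos_ge0; lra.
have t0pi : t0 <= pi by apply: acos_lepi; lra.
have f0 : f 0 = 0 by rewrite /f sin0 mul0r subrr.
have fpi : f (pi / 2) = 0.
  by rewrite /f sin_pihalf mulrA divfK ?divff ?subrr// gt_eqF// pi_gt0.
have t0le : t0 <= pi / 2.
  rewrite leNgt; apply/negP => h.
  have : cos t0 < cos (pi / 2).
    rewrite ltr_cos// in_itv/=; apply/andP; split => //; lra.
  by rewrite cos_pihalf cost0; lra.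
suff : 0 <= f (s / 2) by rewrite /f; lra.
have [st|ts] := leP (s / 2) t0.
  rewrite -f0; apply: (@ger0_derive1_ndecr _ f 0 t0); [| |exact: cf|lra..].
    by move=> t _; have [] := df t.
  move=> t; rewrite in_itv/= => t01; rewrite derive1E; have [_ ->] := df t.
  rewrite subr_ge0 -cost0 ltW// ltr_cos ?in_itv/=; lra.
rewrite -fpi; apply: (@ler0_derive1_nincr _ f t0 (pi / 2)); [| |exact: cf|lra..].
  by move=> t _; have [] := df t.
move=> t; rewrite in_itv/= => t01; rewrite derive1E; have [_ ->] := df t.
rewrite subr_le0 -cost0 ltW// ltr_cos ?in_itv/=; lra.
Qed.

Lemma cos_Nhalf_pi N : cos ((N%:R + 2^-1) * pi) = 0 :> R.
Proof.
rewrite mulrDl [2^-1 * pi]mulrC cosD cos_pihalf sin_pihalf mulr0 mulr1 sub0r.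
by rewrite sin_natpi oppr0.
Qed.

Lemma sawtooth_rest_pi N : sawtooth_rest N pi = 0.
Proof.
rewrite /sawtooth_rest subrr mul0r sub0r /sine_sum big1 ?oppr0// => n _.
by rewrite sin_natpi mul0r.
Qed.

(** Away from the jump at [0] the remainder is of order [1 / N], by one integration
by parts of the Dirichlet kernel. With [k = N + 1 / 2], let [H] be
[1 / (2 k sin (t / 2))]; the derivative of the remainder minus [cos (k t) H] is
dominated by that of [H], so that adding or subtracting [H] makes it monotone,
and its value at [pi] is [0]. *)
Lemma sawtooth_rest_decay N s : 0 < s <= pi ->
  `|sawtooth_rest N s| <= ((N%:R + 2^-1) * sin (s / 2))^-1.
Proof.
move=> /andP[s0 spi]; set k := N%:R + 2^-1.
have k0 : 0 < k by rewrite /k ltr_wpDl// invr_gt0.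
have sin0 t : 0 < t <= pi -> 0 < sin (t / 2).
  by move=> t0; apply: sin_gt0_pi; have := @pi_gt0 R; lra.
pose H t : R := (2 * k * sin (t / 2))^-1.
pose G (c : R) t : R := sawtooth_rest N t + (c - cos (k * t)) * H t.
have dG c t : 0 < t <= pi ->
    is_derive t (1 : R) (G c) ((cos (k * t) - c) * (cos (t / 2) / (4 * k * sin (t / 2) ^+ 2))).
  move=> t0; have st := sin0 t t0.
  have ? := is_derive_sawtooth_rest N t.
  have nz : 2 * k * sin (t / 2) != 0 by rewrite gt_eqF// !mulr_gt0.
  have dH : is_derive t (1 : R) H (- (cos (t / 2) / (4 * k * sin (t / 2) ^+ 2))).
    rewrite /H; apply: is_derive_eq.
    rewrite /GRing.scale/= !mulr0 add0r mulr1 mulNr [_ ^- 2 * _]mulrC.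
    congr (- _); apply/eqP; rewrite eqr_div ?expf_neq0//; first by apply/eqP; lra.
    by rewrite gt_eqF// mulr_gt0 ?exprn_gt0// mulr_gt0.
  rewrite /G; apply: is_derive_eq.
  rewrite /GRing.scale/=.
  have HE : H t * (2 * k * sin (t / 2)) = 1 by rewrite mulVf.
  have := congr1 ( *%R^~ (dirichlet N t)) HE.
  by rewrite -dirichletE -/k => /= {}HE; lra.
have Gpi c : G c pi = c / (2 * k).
  by rewrite /G sawtooth_rest_pi cos_Nhalf_pi /H sin_pihalf mulr1; lra.
have cG c : {within `[s, pi], continuous (G c)}.
  apply: derivable_within_continuous => t; rewrite in_itv/= => t1.
  by have [|] := dG c t; first lra.
have pos t : s < t < pi -> 0 <= cos (t / 2) / (4 * k * sin (t / 2) ^+ 2).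
  move=> t1; have st := sin0 t ltac:(lra).
  rewrite divr_ge0//; last by rewrite mulr_ge0 ?sqr_ge0// mulr_ge0// ltW.
  by apply: cos_ge0_pihalf; lra.
have up : 0 <= G 1 s.
  apply: (@le_trans _ _ (G 1 pi)).
    by rewrite Gpi divr_ge0// mulr_ge0// ltW.
  apply: (@ler0_derive1_nincr _ (G 1) s pi); [| |exact: cG|exact: lexx|exact: spi|exact: lexx].
    move=> t; rewrite in_itv/= => t1.
    by have [|] := dG 1 t; first lra.
  move=> t; rewrite in_itv/= => t1.
  rewrite derive1E; have [|_ ->] := dG 1 t; first lra.
  by rewrite mulr_le0_ge0 ?pos// subr_le0 cos_le1.
have low : G (-1) s <= 0.
  apply: (@le_trans _ _ (G (-1) pi)); last first.
    by rewrite Gpi mulN1r oppr_le0 invr_ge0 mulr_ge0// ltW.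
  apply: (@ger0_derive1_ndecr _ (G (-1)) s pi); [| |exact: cG|exact: lexx|exact: spi|exact: lexx].
    move=> t; rewrite in_itv/= => t1.
    by have [|] := dG (-1) t; first lra.
  move=> t; rewrite in_itv/= => t1.
  rewrite derive1E; have [|_ ->] := dG (-1) t; first lra.
  by rewrite mulr_ge0 ?pos// subr_ge0 cos_geN1.
have H0 : 0 < H s by rewrite invr_gt0 !mulr_gt0// sin0 ?s0.
have -> : (k * sin (s / 2))^-1 = 2 * H s.
  by rewrite /H -mulrA [in RHS]invfM mulVKf// pnatr_eq0.
have := cos_le1 (k * s); have := cos_geN1 (k * s).
move: up low; rewrite /G ler_norml; move: (cos (k * s)) => c up low c1 c2.
have : 0 <= (1 + c) * H s by rewrite mulr_ge0 ?(ltW H0)//; lra.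
have : 0 <= (1 - c) * H s by rewrite mulr_ge0 ?(ltW H0)//; lra.
lra.
Qed.

Lemma sawtooth_rest_sym N s : sawtooth_rest N (pi *+ 2 - s) = - sawtooth_rest N s.
Proof.
rewrite /sawtooth_rest.
have -> : sine_sum N (pi *+ 2 - s) = - sine_sum N s.
  rewrite -sine_sumN; apply: eq_bigr => n _; congr (_ / _).
  have -> : n%:R * (pi *+ 2 - s) = n%:R * - s + pi *+ 2 *+ n.
    by rewrite -[pi *+ 2 *+ n]mulr_natl; lra.
  by rewrite (periodicn (@sinD2pi R)).
lra.
Qed.

(** The remainder starts from [pi / 2] at [0] and decreases as long as the Dirichlet
kernel is positive, in particular up to [2 / k]; from there on the decay estimate
together with Jordan's inequality gives the bound. The reflection
[s |-> 2 pi - s] handles the other half of the period. *)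
Lemma sawtooth_rest_le N s : (0 < N)%N -> 0 <= s < pi *+ 2 ->
  `|sawtooth_rest N s| <= pi / 2.
Proof.
move=> N0; wlog spi : s / s <= pi.
  move=> W s02; have [spi|spi] := leP s pi; first exact: W.
  rewrite -normrN -sawtooth_rest_sym; apply: W; lra.
move=> /andP[s0 _]; have pi2 := @pi_ge2 R.
set k : R := N%:R + 2^-1.
have N1 : 1 <= N%:R :> R by rewrite ler1n.
have k1 : 3 / 2 <= k by rewrite /k; lra.
have large t : 2 / k <= t -> t <= pi -> `|sawtooth_rest N t| <= pi / 2.
  move=> kt tpi.
  have t0 : 0 < t by apply: lt_le_trans kt; rewrite divr_gt0//; lra.
  apply: le_trans (sawtooth_rest_decay N _) _; first by rewrite t0.
  rewrite -/k -[pi / 2]invf_div lef_pV2 ?posrE; last 2 first.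
  - rewrite mulr_gt0//; first lra.
    by apply: sin_gt0_pi; lra.
  - by rewrite divr_gt0// pi_gt0.
  apply: le_trans (_ : k * (t / pi) <= _); last first.
    by rewrite ler_wpM2l//; [lra|apply: sin_half_ge; lra].
  rewrite mulrA ler_pM2r ?invr_gt0 ?pi_gt0//.
  by rewrite ler_pdivrMr in kt; lra.
have [kt|tk] := leP (2 / k) s; first exact: large.
have kpi : 2 / k <= pi.
  by rewrite ler_pdivrMr; [nra|lra].
have anti a b : 0 <= a -> a <= b -> b <= 2 / k -> sawtooth_rest N b <= sawtooth_rest N a.
  move=> a0 ab bk; apply: (@ler0_derive1_nincr _ (sawtooth_rest N) 0 (2 / k));
    [| | |exact: a0|exact: ab|exact: bk].
  - by move=> t _; have [] := is_derive_sawtooth_rest N t.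
  - move=> t; rewrite in_itv/= => /andP[t0 tk'].
    rewrite derive1E; have [_ ->] := is_derive_sawtooth_rest N t.
    rewrite oppr_le0.
    have st : 0 < 2 * sin (t / 2) by rewrite mulr_gt0// sin_gt0_pi//; lra.
    rewrite -(pmulr_rge0 _ st) dirichletE sin_ge0_pi// -/k.
    move: tk'; rewrite ltr_pdivlMr; last lra.
    by move=> tk'; rewrite mulr_ge0/=; lra.
  - exact/continuous_subspaceT/continuous_sawtooth_rest.
have s00 : sawtooth_rest N 0 = pi / 2.
  rewrite /sawtooth_rest subr0 /sine_sum big1 ?subr0// => n _.
  by rewrite mulr0 sin0 mul0r.
have := anti 0 s (lexx _) s0 (ltW tk); rewrite s00 => h1.
have := anti s (2 / k) s0 (ltW tk) (lexx _) => h2.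
have := large _ (lexx _) kpi; rewrite !ler_norml; lra.
Qed.

End sawtooth.

(** * Estimates by the variation of the function itself *)

Section coefficients.
Context {R : realType}.
Notation mu := (@lebesgue_measure R).
Implicit Types (f g v : R -> R) (x y V : R) (n m N : nat).

Lemma chebyshevS_le n x : `|chebyshevS n x| <= n%:R^-1.
Proof.
by rewrite /chebyshevS normrM normfV normr_nat ler_piMl// sin_max.
Qed.

(** [T_n] times the weight has mean zero and the primitive [- chebyshevS n], which is
at most [1 / n]. *)
Lemma chebyshev_coef_TV v V n : (TV_Omega v <= V%:E)%E -> (0 < n)%N ->
  `|chebyshev_coef v n| <= 2 / pi * (V / n%:R).
Proof.
move=> TVv n0; have bv := TV_Omega_bounded_measurable TVv.
have bT := @bounded_measurable_chebyshevT R n.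
have O0 : Omega (0 : R) by rewrite OmegaE; lra.
have pi0 := @pi_gt0 R.
rewrite chebyshev_coefE normrM gtr0_norm ?divr_gt0// ler_pM2l ?divr_gt0//.
have -> : wint (v \* chebyshevT n) =
    \int[mu]_(y in Omega) ((v y - v 0) * (chebyshevT n \* weight) y).
  have -> : wint (v \* chebyshevT n) =
      wint ((v \* chebyshevT n) \- (fun y => v 0 * chebyshevT n y)).
    rewrite wintB; [|exact: bounded_measurableM|exact: bounded_measurableZ].
    by rewrite (wintZ _ bT) wint_chebyshevT// mulr0 subr0.
  by apply: eq_Rintegral => y _ /=; lra.
apply: bounded_variation_pairing TVv _ _ _ O0 _ _ _.
- exact: chebyshevT_weight_integrable.
- move=> y; rewrite OmegaE => y1 _.
  by rewrite Rintegral_chebyshevT_left// ?normrN ?chebyshevS_le//; lra.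
- move=> y; rewrite OmegaE => y1 _.
  by rewrite Rintegral_chebyshevT_right// chebyshevS_le.
Qed.

Lemma continuous_kernel N x y : -1 < y < 1 -> {for y, continuous (chebyshev_kernel N x)}.
Proof.
move=> y1; elim: N => [|N IH].
  have -> : chebyshev_kernel 0 x = cst 2^-1.
    by apply/funext => t; rewrite /chebyshev_kernel big_geq// addr0.
  exact: cst_continuous.
have -> : chebyshev_kernel N.+1 x = chebyshev_kernel N x \+ (fun t => chebyshevT N.+1 x * chebyshevT N.+1 t).
  by apply/funext => t; rewrite /chebyshev_kernel big_nat_recr//= addrA.
by apply: cvgD; [exact: IH|apply: cvgMl_tmp; exact: continuous_chebyshevT].
Qed.

Section kernel_primitive.
Variables (N : nat) (x : R).
Hypothesis Ox : -1 < x < 1.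

(* A primitive, in the second variable, of the kernel times the weight. In the
   variables [acos x] and [acos y] it is a sum of two sine sums. *)
Let S y := \sum_(1 <= n < N.+1) 2 * chebyshevT n x * chebyshevS n y.
Let F y : R := - pi^-1 * (acos y + S y).

Let SE y : S y = sine_sum N (acos y + acos x) + sine_sum N (acos y - acos x).
Proof.
rewrite /S /sine_sum -big_split/=; apply: eq_bigr => n _.
rewrite /chebyshevT /chebyshevS -mulrDl mulrA; congr (_ / _).
by rewrite mulrDr mulrBr sinD sinB; lra.
Qed.

Let cF : {within `[-1, 1], continuous F}.
Proof.
pose h t : R := - pi^-1 * (t + (sine_sum N (t + acos x) + sine_sum N (t - acos x))).
have -> : F = h \o acos by apply/funext => y; rewrite /F SE.
apply: (@within_continuous_comp _ _ _ _ (@acos R) h _ within_continuous_acos).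
have cS : continuous (@sine_sum R N).
  move=> t; apply/differentiable_continuous/derivable1_diffP.
  by have [] := is_derive_sine_sum N t.
have cD c : continuous (fun t : R => t + c).
  by move=> t; apply: cvgD; [exact: cvg_id|exact: cvg_cst].
move=> t _; apply: cvgMl_tmp; apply: cvgD; first exact: cvg_id.
apply: cvgD.
  by apply: (@continuous_comp _ _ _ (fun t => t + acos x)); [exact: cD|exact: cS].
by apply: (@continuous_comp _ _ _ (fun t => t - acos x)); [exact: cD|exact: cS].
Qed.

Let F'k y : -1 < y < 1 -> is_derive y (1 : R) F (2 / pi * (chebyshev_kernel N x y * weight y)).
Proof.
move=> y1; have dS : is_derive y (1 : R) S
    (\sum_(1 <= n < N.+1) 2 * chebyshevT n x * - (chebyshevT n y * weight y)).
  rewrite /S; elim: N => [|k IH].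
    rewrite (_ : (fun _ => _) = cst 0); last by apply/funext => t; rewrite big_geq.
    by rewrite big_geq//; exact: is_derive_cst.
  rewrite (_ : (fun _ => _) = (fun y => \sum_(1 <= n < k.+1) 2 * chebyshevT n x * chebyshevS n y)
     \+ (fun y => 2 * chebyshevT k.+1 x * chebyshevS k.+1 y)); last first.
    by apply/funext => t; rewrite big_nat_recr.
  rewrite big_nat_recr//=; apply: is_deriveD.
  have ? := @is_derive_chebyshevS R k.+1 y isT y1.
  by apply: is_derive_eq; rewrite /GRing.scale/=; lra.
have ? := is_derive_acos y1.
rewrite /F; apply: is_derive_eq; rewrite /GRing.scale/= /chebyshev_kernel.
have -> : \sum_(1 <= n < N.+1) 2 * chebyshevT n x * - (chebyshevT n y * weight y) =
   - (2 * weight y) * \sum_(1 <= n < N.+1) chebyshevT n x * chebyshevT n y.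
  by rewrite mulr_sumr; apply: eq_bigr => n _; lra.
lra.
Qed.

Let ck y : -1 < y < 1 ->
  {for y, continuous (fun y => 2 / pi * (chebyshev_kernel N x y * weight y))}.
Proof.
move=> y1; apply: cvgMl_tmp; apply: (@cvgM R _ (nbhs y) _ (chebyshev_kernel N x) weight).
  exact: continuous_kernel.
exact: continuous_weight.
Qed.

Let ik : mu.-integrable (Omega : set R)
  (EFin \o (fun y => 2 / pi * (chebyshev_kernel N x y * weight y))).
Proof.
have := integrableZl (@measurable_Omega R) (2 / pi)
  (bounded_measurable_weight (bounded_measurable_kernel N x)).
by apply: eq_integrable => //; exact: measurable_Omega.
Qed.

(** Up to the factor [1 / pi], the integral is the sum of the sawtooth remainders
at [acos y + acos x] and [acos y - acos x]. *)
Lemma kernel_left y : (0 < N)%N -> -1 < y < 1 -> y <= x ->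
  `|\int[mu]_(t in `]-1, y[) (2 / pi * (chebyshev_kernel N x t * weight t))| <= 1.
Proof.
move=> N0 y1 yx; have pi0 := @pi_gt0 R; have x1 := Ox.
have le1 : -1 <= y <= 1 by lra.
rewrite (@Rintegral_left R F _ cF F'k ck ik y le1).
have -> : F y - F (-1) = pi^-1 * (sawtooth_rest N (acos y + acos x)
    + sawtooth_rest N (acos y - acos x)).
  have SN1 : S (-1) = 0 by rewrite /S big1// => n _; rewrite chebyshevSN1 mulr0.
  rewrite /F SN1 acosN1 SE /sawtooth_rest.
  have := @mulVf R pi; rewrite gt_eqF// => /(_ isT); lra.
have xy : acos x <= acos y.
  rewrite leNgt; apply/negP => h.
  have ax := acos_itv Ox; have ay := acos_itv y1.
  have : cos (acos x) < cos (acos y) by rewrite ltr_cos ?in_itv/=; lra.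
  have xI : x \in `[-1, 1] by rewrite in_itv/=; lra.
  have yI : y \in `[-1, 1] by rewrite in_itv/=; lra.
  by rewrite !acosK// ltNge yx.
have ax := acos_itv Ox; have ay := acos_itv y1.
have h1 := @sawtooth_rest_le R N (acos y + acos x) N0 ltac:(lra).
have h2 := @sawtooth_rest_le R N (acos y - acos x) N0 ltac:(lra).
rewrite normrM gtr0_norm ?invr_gt0// mulrC ler_pdivrMr// mul1r.
by apply: le_trans (ler_normD _ _) _; lra.
Qed.

Lemma kernel_right y : (0 < N)%N -> -1 < y < 1 -> x <= y ->
  `|\int[mu]_(t in `]y, 1[) (2 / pi * (chebyshev_kernel N x t * weight t))| <= 1.
Proof.
move=> N0 y1 yx; have pi0 := @pi_gt0 R; have x1 := Ox.
rewrite (@Rintegral_right R F _ cF F'k ck ik y y1).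
have -> : F 1 - F y = pi^-1 * (sawtooth_rest N (acos x - acos y)
    - sawtooth_rest N (acos y + acos x)).
  have S1 : S 1 = 0 by rewrite /S big1// => n _; rewrite chebyshevS1 mulr0.
  by rewrite /F S1 acos1 SE /sawtooth_rest -(opprB (acos x)) sine_sumN; lra.
have xy : acos y <= acos x.
  rewrite leNgt; apply/negP => h.
  have ax := acos_itv Ox; have ay := acos_itv y1.
  have : cos (acos y) < cos (acos x) by rewrite ltr_cos ?in_itv/=; lra.
  have xI : x \in `[-1, 1] by rewrite in_itv/=; lra.
  have yI : y \in `[-1, 1] by rewrite in_itv/=; lra.
  by rewrite !acosK// ltNge yx.
have ax := acos_itv Ox; have ay := acos_itv y1.
have h1 := @sawtooth_rest_le R N (acos y + acos x) N0 ltac:(lra).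
have h2 := @sawtooth_rest_le R N (acos x - acos y) N0 ltac:(lra).
rewrite normrM gtr0_norm ?invr_gt0// mulrC ler_pdivrMr// mul1r.
by apply: le_trans (ler_normB _ _) _; lra.
Qed.

End kernel_primitive.

(** The integrals of the kernel over intervals reaching an end point are, up to
sign, the errors at [x] of Heaviside steps, and these are at most one. *)
Lemma chebyshev_error_TV v V N x : (TV_Omega v <= V%:E)%E -> (0 < N)%N ->
  Omega x -> `|v x - chebyshev_sum N v x| <= V.
Proof.
move=> TVv N0 Ox; have bv := TV_Omega_bounded_measurable TVv.
have x1 : -1 < x < 1 by rewrite -OmegaE.
have bk := bounded_measurable_kernel N x.
rewrite chebyshev_errorE//.
have -> : 2 / pi * wint ((fun y => v x - v y) \* chebyshev_kernel N x) =
    - \int[mu]_(y in Omega) ((v y - v x) * (2 / pi * (chebyshev_kernel N x y * weight y))).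
  have bvk : bounded_measurable ((fun y => v x - v y) \* chebyshev_kernel N x).
    by apply: bounded_measurableM => //; apply: bounded_measurableB => //; exact: bounded_measurable_cst.
  rewrite -mulN1r -wintZ// /wint -RintegralZl.
  - by apply: eq_Rintegral => y _ /=; lra.
  - exact: measurable_Omega.
  - have := integrableZl (@measurable_Omega R) (- (2 / pi)) (bounded_measurable_weight bvk).
    by apply: eq_integrable => [|y _ /=]; [exact: measurable_Omega|congr (_%:E); lra].
rewrite normrN -[leRHS]mulr1; apply: bounded_variation_pairing TVv _ _ _ Ox _ _ _.
- have := integrableZl (@measurable_Omega R) (2 / pi) (bounded_measurable_weight bk).
  by apply: eq_integrable => //; exact: measurable_Omega.
- by move=> y Oy yx; apply: kernel_left => //; rewrite -OmegaE.
- by move=> y Oy yx; apply: kernel_right => //; rewrite -OmegaE.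
Qed.

End coefficients.

(** * Coefficients of functions with several derivatives *)

Section smooth_coefficients.
Context {R : realType}.
Notation mu := (@lebesgue_measure R).
Implicit Types (f g : R -> R) (v : nat -> R -> R) (x y V a : R) (n m k N : nat).

Lemma absolutely_continuous_bounded_measurable f :
  absolutely_continuous (-1) 1 f -> bounded_measurable f.
Proof.
move=> acf; apply: bounded_measurable_continuous.
by apply: absolutely_continuous_within => //; lra.
Qed.

Lemma chebyshevS_weight n x : -1 < x < 1 ->
  chebyshevS n.+1 x =
  (chebyshevT n x - chebyshevT n.+2 x) * weight x / (2 * n.+1%:R).
Proof.
move=> x1; rewrite /chebyshevS /chebyshevT /weight -sin_acos; last by lra.
have s0 : sin (acos x) != 0 by rewrite gt_eqF// sin_gt0_pi// acos_itv.
have -> : n%:R * acos x = n.+1%:R * acos x - acos x by rewrite -[n.+1%:R]natr1; lra.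
have -> : n.+2%:R * acos x = n.+1%:R * acos x + acos x by rewrite -[n.+2%:R]natr1; lra.
rewrite cosB cosD.
rewrite [X in X / sin _](_ : _ = 2 * sin (n.+1%:R * acos x) * sin (acos x)); last by lra.
by rewrite mulfK// invfM mulrACA divff ?mul1r// pnatr_eq0.
Qed.

(** Integration by parts against [chebyshevS n.+1], which vanishes at both end
points and is itself a combination of [T_n weight] and [T_(n+2) weight]. *)
Lemma chebyshev_coef_derive f g n : absolutely_continuous (-1) 1 f ->
  bounded_measurable g ->
  {ae mu, forall x, Omega x -> is_derive x (1 : R) f (g x)} ->
  chebyshev_coef f n.+1 =
  (chebyshev_coef g n - chebyshev_coef g n.+2) / (2 * n.+1%:R).
Proof.
move=> acf bg f'g; have bf := absolutely_continuous_bounded_measurable acf.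
have bT k := @bounded_measurable_chebyshevT R k.
have n0 : 2 * n.+1%:R != 0 :> R by rewrite mulf_neq0 ?pnatr_eq0.
have le11 : -1 < 1 :> R by lra.
have [M fM] := within_continuous_bounded (absolutely_continuous_within le11 acf).
have acS : absolutely_continuous (-1) 1 (@chebyshevS R n.+1).
  apply: (@integrable_derivative_absolutely_continuous R _ _ _
    (fun y => - (chebyshevT n.+1 y * weight y)) le11).
  - exact: within_continuous_chebyshevS.
  - by move=> x; exact: is_derive_chebyshevS.
  - by move=> x x1; apply: cvgN; exact: continuous_chebyshevT_weight.
  - have := integrableZl (@measurable_Omega R) (-1) (chebyshevT_weight_integrable n.+1).
    apply: eq_integrable => [|y _ /=]; first exact: measurable_Omega.
    by congr (_%:E); lra.
have acfS := absolutely_continuousM fM (fun x _ => chebyshevS_le n.+1 x) acf acS.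
pose p x := (2 * n.+1%:R)^-1 * ((g \* chebyshevT n) \- (g \* chebyshevT n.+2)) x.
have bp : bounded_measurable p.
  by apply: bounded_measurableZ; apply: bounded_measurableB; exact: bounded_measurableM.
have bfT := bounded_measurableM bf (bT n.+1).
have := @absolutely_continuous_FTC R _ _ _ (fun x => (p x - f x * chebyshevT n.+1 x) * weight x) acfS.
have -> : mu.-integrable `]-1, 1[ (EFin \o (fun x => (p x - f x * chebyshevT n.+1 x) * weight x)).
  exact: bounded_measurable_weight (bounded_measurableB bp bfT).
move=> /(_ isT) FTC.
have dh : {ae mu, forall x, -1 < x < 1 -> is_derive x (1 : R) (f \* chebyshevS n.+1)
    ((p x - f x * chebyshevT n.+1 x) * weight x)}.
  apply: (@filterS _ _ (ae_filter_ringOfSetsType mu) _ _ _ f'g) => x.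
  rewrite OmegaE => df x1; have ? := df x1.
  have ? := @is_derive_chebyshevS R n.+1 x isT x1.
  apply: is_derive_eq; rewrite /GRing.scale/= chebyshevS_weight// /p /=.
  by move: (2 * n.+1%:R)^-1 => K; lra.
have : wint (p \- (f \* chebyshevT n.+1)) = 0.
  rewrite /wint FTC; [|exact: dh|by rewrite lexx; lra].
  by rewrite /= chebyshevS1 chebyshevSN1 !mulr0 subrr.
rewrite wintB// wintZ; last by apply: bounded_measurableB; exact: bounded_measurableM.
rewrite wintB; [|exact: bounded_measurableM..].
move=> /(congr1 ( *%R (2 / pi))); rewrite !chebyshev_coefE.
by move: (2 * n.+1%:R)^-1 => K; lra.
Qed.

Definition step2_prod a k : R := \prod_(j < k) (a + 2 * j%:R)^-1.

Lemma step2_prodSr a k : step2_prod a k.+1 = step2_prod a k / (a + 2 * k%:R).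
Proof. by rewrite /step2_prod big_ord_recr. Qed.

Lemma step2_prodSl a k : step2_prod a k.+1 = step2_prod (a + 2) k / a.
Proof.
rewrite /step2_prod big_ord_recl/= mulr0 addr0 mulrC; congr (_ / _).
by apply: eq_bigr => j _; rewrite /bump/= add1n -[j.+1%:R]natr1; congr (_^-1); lra.
Qed.

Lemma step2_prod_gt0 a k : 0 < a -> 0 < step2_prod a k.
Proof.
by move=> a0; apply: prodr_gt0 => j _; rewrite invr_gt0 ltr_wpDr// mulr_ge0.
Qed.

Lemma step2_prod_succ a k : 0 < a ->
  step2_prod a k = (a + 2 * k%:R) * step2_prod a k.+1.
Proof.
move=> a0; rewrite step2_prodSr mulrCA divff ?mulr1// gt_eqF//.
by rewrite ltr_wpDr// mulr_ge0.
Qed.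

Lemma step2_prod_shift a k : 0 < a ->
  step2_prod (a + 2) k = a * step2_prod a k.+1.
Proof. by move=> a0; rewrite step2_prodSl mulrCA divff ?mulr1// gt_eqF. Qed.

Lemma step2_prod_le a b k : 0 < a -> a <= b -> step2_prod b k <= step2_prod a k.
Proof.
move=> a0 ab; apply: ler_prod => j _.
have j0 : 0 <= 2 * j%:R :> R by rewrite mulr_ge0.
rewrite invr_ge0 lef_pV2 ?posrE; lra.
Qed.

(** Induction on the number of derivatives. In the step to [k + 1], with
[a = n - (k + 1)], the bounds for the two coefficients of the derivative have the
denominators [a (a + 2) ... (a + 2 k)] and [(a + 2) ... (a + 2 k + 2)], and their
sum is exactly [2 n] times the bound with denominator [a (a + 2) ... (a + 2 k + 2)]. *)
Lemma chebyshev_coef_smooth k : forall v V n,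
  (forall j, (j < k)%N -> absolutely_continuous (-1) 1 (v j)) ->
  (forall j, (j < k)%N -> {ae mu, forall x, Omega x -> is_derive x (1 : R) (v j) (v j.+1 x)}) ->
  (TV_Omega (v k) <= V%:E)%E -> (k < n)%N ->
  `|chebyshev_coef (v 0%N) n| <= 2 / pi * (V * step2_prod (n%:R - k%:R) k.+1).
Proof.
elim: k => [|k IH] v V n acv dv TVv kn.
  rewrite /step2_prod big_ord1 subr0 mulr0 addr0; exact: chebyshev_coef_TV.
case: n kn => // n kn.
have bv1 : bounded_measurable (v 1%N).
  case: k {IH kn} acv dv TVv => [|k] acv dv TVv.
    exact: TV_Omega_bounded_measurable TVv.
  exact: absolutely_continuous_bounded_measurable (acv 1%N isT).
rewrite (chebyshev_coef_derive n (acv 0%N isT) bv1 (dv 0%N isT)).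
have H i : (k < i)%N -> `|chebyshev_coef (v 1%N) i| <= 2 / pi * (V * step2_prod (i%:R - k%:R) k.+1).
  by move=> ki; apply: (IH (fun j => v j.+1)) => // j jk; [exact: acv|exact: dv].
have := H n kn; have := H n.+2 (leqW (leqW kn)).
set a : R := n.+1%:R - k.+1%:R.
have a0 : 0 < a by rewrite subr_gt0 ltr_nat.
have -> : n%:R - k%:R = a by rewrite /a -[n.+1%:R]natr1 -[k.+1%:R]natr1; lra.
have -> : n.+2%:R - k%:R = a + 2.
  by rewrite /a -[n.+2%:R]natr1 -[n.+1%:R]natr1 -[k.+1%:R]natr1; lra.
rewrite step2_prod_shift// (step2_prod_succ k.+1 a0).
set Q := step2_prod a k.+2; move=> h2 h1.
have n0 : 0 < 2 * n.+1%:R :> R by rewrite mulr_gt0.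
rewrite normrM normfV (gtr0_norm n0) ler_pdivrMr//.
apply: le_trans (ler_normB _ _) _; apply: le_trans (lerD h1 h2) _.
rewrite le_eqVlt; apply/orP; left; apply/eqP.
by rewrite /a; lra.
Qed.

(** With [a = n - m], the summand is [1 / (2 m)] times the difference of
[step2_prod a m] and [step2_prod (a + 2) m], so the sum telescopes with step two. *)
Lemma step2_prod_telescope m N M : (0 < m)%N -> (m <= N)%N -> (N <= M)%N ->
  2 * m%:R * (\sum_(N.+1 <= n < M.+1) step2_prod (n%:R - m%:R) m.+1) <=
  step2_prod (N%:R - m%:R + 1) m + step2_prod (N%:R - m%:R + 2) m.
Proof.
move=> m0 mN; pose A n := step2_prod (n%:R - m%:R + 1) m.
have pos n : (N <= n)%N -> 0 < n%:R - m%:R + 1 :> R.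
  by move=> Nn; have := leq_trans mN Nn; rewrite -(ler_nat R); lra.
have {}IH M' : (N <= M')%N -> 2 * m%:R * (\sum_(N.+1 <= n < M'.+1) step2_prod (n%:R - m%:R) m.+1) =
   A N + A N.+1 - A M' - A M'.+1.
  elim: M' => [|k IH].
    by rewrite leqn0 => /eqP ->; rewrite big_geq//; lra.
  rewrite leq_eqVlt => /predU1P[<-|]; first by rewrite big_geq//; lra.
  rewrite ltnS => Nk; rewrite big_nat_recr ?ltnS//= mulrDr IH//.
  have ak : 0 < k.+1%:R - m%:R :> R by have := pos k Nk; rewrite -[k.+1%:R]natr1; lra.
  have -> : A k = (k.+1%:R - m%:R + 2 * m%:R) * step2_prod (k.+1%:R - m%:R) m.+1.
    rewrite -step2_prod_succ// /A; congr (step2_prod _ _); rewrite -[k.+1%:R]natr1; lra.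
  have -> : A k.+2 = (k.+1%:R - m%:R) * step2_prod (k.+1%:R - m%:R) m.+1.
    rewrite -step2_prod_shift// /A; congr (step2_prod _ _); rewrite -[k.+2%:R]natr1; lra.
  lra.
move=> NM; rewrite IH//.
have -> : step2_prod (N%:R - m%:R + 2) m = A N.+1.
  by rewrite /A; congr (step2_prod _ _); rewrite -[N.+1%:R]natr1; lra.
have := step2_prod_gt0 m (pos M NM); have := step2_prod_gt0 m (pos M.+1 (leqW NM)).
rewrite /A; lra.
Qed.

Lemma chebyshev_coef_tail m v V N M : (0 < m)%N -> (m <= N)%N -> (N <= M)%N ->
  (forall j, (j < m)%N -> absolutely_continuous (-1) 1 (v j)) ->
  (forall j, (j < m)%N -> {ae mu, forall x, Omega x -> is_derive x (1 : R) (v j) (v j.+1 x)}) ->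
  (TV_Omega (v m) <= V%:E)%E ->
  \sum_(N.+1 <= n < M.+1) `|chebyshev_coef (v 0%N) n| <=
  (step2_prod (N%:R - m%:R + 1) m + step2_prod (N%:R - m%:R + 2) m) / (m%:R * pi) * V.
Proof.
move=> m0 mN NM acv dv TVv; have pi0 := @pi_gt0 R.
have V0 : 0 <= V.
  have O0 : Omega (0 : R) by rewrite OmegaE; lra.
  by apply: le_trans (TV_Omega_osc TVv O0 O0).
have m0' : 0 < m%:R :> R by rewrite ltr0n.
apply: (@le_trans _ _ (\sum_(N.+1 <= n < M.+1) 2 / pi * V * step2_prod (n%:R - m%:R) m.+1)).
  rewrite big_nat_cond [leRHS]big_nat_cond; apply: ler_sum => n /andP[/andP[Nn _] _].
  rewrite -mulrA; apply: chebyshev_coef_smooth => //.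
  exact: leq_trans Nn.
rewrite -mulr_sumr; have := step2_prod_telescope m0 mN NM.
set S := \sum_(_ <= _ < _) _; set B := _ + _ => SB.
rewrite [leRHS](_ : _ = 2 / pi * V * (B / (2 * m%:R))); last first.
  by rewrite !invfM; move: m%:R^-1 pi^-1 => c1 c2; lra.
apply: ler_wpM2l; first by rewrite mulr_ge0// divr_ge0// ltW.
by rewrite ler_pdivlMr ?mulr_gt0//; lra.
Qed.

End smooth_coefficients.

(** * The error of the mean for a function with one derivative *)

Section first_order.
Context {R : realType}.
Notation mu := (@lebesgue_measure R).
Implicit Types (f g : R -> R) (x y p q V : R).

Lemma absolutely_continuous_slope f g p q :
  absolutely_continuous (-1) 1 f -> bounded_measurable g ->
  {ae mu, forall x, Omega x -> is_derive x (1 : R) f (g x)} ->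
  (forall x, Omega x -> p <= g x <= q) ->
  forall y x, -1 <= y -> y <= x -> x <= 1 ->
  p * (x - y) <= f x - f y <= q * (x - y).
Proof.
move=> acf [mg [M gM]] f'g gpq y x y1 yx x1.
have sub : `]y, x[ `<=` (Omega : set R).
  by move=> t; rewrite OmegaE /= in_itv/=; lra.
have mI : measurable (`]y, x[ : set (measurableTypeR R)) by exact: measurable_itv.
have muI : mu `]y, x[ = (x - y)%:E.
  rewrite lebesgue_measure_itv/= lte_fin; case: ltP => // xy.
  by rewrite (_ : x = y) ?subrr//; apply/eqP; rewrite eq_le xy yx.
have ic (c : R) : mu.-integrable `]y, x[ (EFin \o (fun=> c)).
  apply: (measurable_bounded_integrable (f := fun=> c)) => //.
    by apply: (@le_lt_trans _ _ (x - y)%:E); [rewrite -muI|exact: ltry].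
  exact: bounded_cst.
have ig : mu.-integrable `]y, x[ (EFin \o g).
  apply: le_integrable (ic M) => //.
    by apply/measurable_EFinP; exact: measurable_funS (@measurable_Omega R) sub mg.
  move=> t /sub Ot; rewrite lee_fin (le_trans (gM t Ot))// ler_norm//.
have int_cst (c : R) : \int[mu]_(t in `]y, x[) c = c * (x - y).
  by rewrite Rintegral_cst//; congr (_ * _); rewrite -[RHS]/(fine (x - y)%:E) -muI.
have <- : \int[mu]_(t in `]y, x[) g t = f x - f y.
  apply: (@absolutely_continuous_FTC R y x f g); [|by []| |by rewrite yx lexx].
    exact: absolutely_continuous_sub acf.
  apply: (@filterS _ _ (ae_filter_ringOfSetsType mu) _ _ _ f'g) => t df tyx.
  by apply: df; rewrite OmegaE; lra.
rewrite -!int_cst; apply/andP; split; apply: le_Rintegral => // t /sub /gpq; lra.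
Qed.

(** [tan (pi / 8)] is the positive root of [t ^ 2 + 2 t = 1], hence at most
[5 / 12], while [pi / 8 <= tan (pi / 8)]. *)
Lemma pi_le_10div3 : pi <= 10 / 3 :> R.
Proof.
have pi0 := @pi_gt0 R; have piq : pi / 4 = pi / 8 + pi / 8 :> R by lra.
have pih : pi / 2 = pi / 4 + pi / 4 :> R by lra.
have c4 : 0 < cos (pi / 4) :> R by apply: cos_gt0_pihalf; lra.
have s4 : 0 < sin (pi / 4) :> R by apply: sin_gt0_pihalf; lra.
have c8 : 0 < cos (pi / 8) :> R by apply: cos_gt0_pihalf; lra.
have s8 : 0 < sin (pi / 8) :> R by apply: sin_gt0_pihalf; lra.
have E4 : cos (pi / 4) = sin (pi / 4) :> R.
  have := @cos_pihalf R; rewrite pih cosD => /eqP; rewrite subr_eq0 -!expr2 eqf_sqr.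
  by move=> /orP[/eqP//|/eqP]; lra.
rewrite piq cosD sinD in E4.
have tan_ge : pi / 8 * cos (pi / 8) <= sin (pi / 8) :> R.
  pose f t : R := sin t - t * cos t.
  have df t : is_derive t (1 : R) f (t * sin t).
    by rewrite /f; apply: is_derive_eq; rewrite /GRing.scale/=; lra.
  have : f 0 <= f (pi / 8).
    apply: (@ger0_derive1_ndecr _ f 0 (pi / 8)); [| | |lra..].
    - by move=> t _; have [] := df t.
    - move=> t; rewrite in_itv/= => t1; rewrite derive1E; have [_ ->] := df t.
      by rewrite mulr_ge0 ?sin_ge0_pi//; lra.
    - apply: continuous_subspaceT => t; apply/differentiable_continuous/derivable1_diffP.
      by have [] := df t.
  by rewrite /f sin0 mul0r subrr; lra.
have tan_le : 12 * sin (pi / 8) <= 5 * cos (pi / 8) :> R by nra.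
have : pi / 8 * cos (pi / 8) <= 5 / 12 * cos (pi / 8) :> R by lra.
by rewrite ler_pM2r//; lra.
Qed.

(** Removing the slope [p] common to the whole graph lowers the oscillation by
the total rise [2 p] of that slope. *)
Lemma oscillation_sub_slope f p V : 0 <= p ->
  (forall y x, -1 <= y -> y <= x -> x <= 1 -> p * (x - y) <= f x - f y) ->
  (forall x y, Omega x -> Omega y -> `|f x - f y| <= V) ->
  forall x y, Omega x -> Omega y ->
  `|(f x - p * x) - (f y - p * y)| <= V - 2 * p.
Proof.
move=> p0 slope osc.
suff H x y : Omega x -> Omega y -> y <= x ->
    `|(f x - p * x) - (f y - p * y)| <= V - 2 * p.
  move=> x y Ox Oy; have [yx|/ltW xy] := leP y x; first exact: H.
  by rewrite distrC; exact: H.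
rewrite !OmegaE => x1 y1 yx.
have := slope y x ltac:(lra) yx ltac:(lra) => syx.
rewrite ger0_norm; last by lra.
apply/ler_addgt0Pr => e e0.
(* Apply the bound [V] close to the end points, at [-1 + h] and [1 - h]; the two
   missing pieces of slope [p] cost [2 p h <= e]. *)
pose h := Num.min (e / (2 * p + 1)) (Num.min (1 - x) (1 + y)).
have p1 : 0 < 2 * p + 1 by lra.
have h0 : 0 < h by rewrite !lt_min divr_gt0//; lra.
have he : h * (2 * p + 1) <= e by rewrite -ler_pdivlMr// ge_min lexx.
have hx : h <= 1 - x by rewrite !ge_min lexx orbT.
have hy : h <= 1 + y by rewrite !ge_min lexx !orbT.
have := osc (1 - h) (-1 + h); rewrite !OmegaE => /(_ ltac:(lra) ltac:(lra)).
rewrite ler_norml => o.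
have := slope x (1 - h) ltac:(lra) ltac:(lra) ltac:(lra).
have := slope (-1 + h) y ltac:(lra) ltac:(lra) ltac:(lra).
nra.
Qed.

(** For [m = 1] and [N = 0] the coefficient bounds alone are not sharp enough.
Here the error is the mean of [f x - f y] against [weight / pi]; after removing a
linear part [d * x], the increment is at most the convex combination, with weights
[2 / pi] and [1 - 2 / pi], of its bounds by the variation of [f] and by that of
[f']. *)
Lemma chebyshev_mean_error f g V0 V1 x :
  absolutely_continuous (-1) 1 f ->
  {ae mu, forall x, Omega x -> is_derive x (1 : R) f (g x)} ->
  (TV_Omega f <= V0%:E)%E -> (TV_Omega g <= V1%:E)%E -> Omega x ->
  `|f x - chebyshev_sum 0 f x| <= 2 / pi * V0 + 4 / (3 * pi) * V1.
Proof.
move=> acf f'g TV0 TV1 Ox.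
have bg := TV_Omega_bounded_measurable TV1.
have bf := absolutely_continuous_bounded_measurable acf.
have osc := fun s t => @TV_Omega_osc R f V0 TV0 s t.
have O0 : Omega (0 : R) by rewrite OmegaE; lra.
have pi0 := @pi_gt0 R; have pi3 := pi_le_10div3.
have V1g : forall s t, Omega s -> Omega t -> g s - g t <= V1.
  by move=> s t Os Ot; apply: le_trans (TV_Omega_osc TV1 Os Ot); exact: ler_norm.
have V10 : 0 <= V1 by have := V1g 0 0 O0 O0; rewrite subrr.
have V00 : 0 <= V0 by apply: le_trans (osc 0 0 O0 O0).
pose p := inf (g @` Omega).
have lbg : has_lbound (g @` Omega).
  by exists (g 0 - V1) => _ [s Os <-]; have := V1g 0 s O0 Os; lra.
have gp s : Omega s -> p <= g s <= p + V1.
  move=> Os; apply/andP; split; first by apply: (ge_inf lbg); exists s.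
  suff : g s - V1 <= p by lra.
  apply: lb_le_inf; first by exists (g 0); exists 0.
  by move=> _ [t Ot <-]; have := V1g s t Os Ot; lra.
have slope := absolutely_continuous_slope acf bg f'g gp.
(* [d] is the point of [[p, p + V1]], an interval containing the slopes, that is
   closest to [0]. *)
have [d [[pd dp] dosc]] : exists d : R, (p <= d /\ d <= p + V1) /\
   forall s t, Omega s -> Omega t ->
   `|(f s - d * s) - (f t - d * t)| <= V0 - 2 * `|d|.
  have [p0|p0] := leP 0 p.
    exists p; split; first lra.
    rewrite ger0_norm//; apply: oscillation_sub_slope => // t s t1 ts s1.
    by have /andP[] := slope t s t1 ts s1.
  have [p1|p1] := leP (p + V1) 0.
    exists (p + V1); split; first lra.
    rewrite ler0_norm// => s t Os Ot.
    have := @oscillation_sub_slope (\- f) (- (p + V1)) V0.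
    rewrite oppr_ge0 => /(_ p1) H.
    rewrite -normrN opprB.
    have /= := H _ _ s t Os Ot; rewrite (_ : - f s - - (p + V1) * s -
      (- f t - - (p + V1) * t) = f t - (p + V1) * t - (f s - (p + V1) * s)); last by lra.
    apply.
      move=> b a b1 ba a1 /=; have /andP[_] := slope b a b1 ba a1; lra.
    by move=> a b Oa Ob /=; rewrite -normrN opprD !opprK; exact: osc.
  exists 0; split; first lra.
  by move=> s t Os Ot; rewrite normr0 !mul0r mulr0 !subr0; exact: osc.
have lip t : Omega t -> `|(f x - d * x) - (f t - d * t)| <= V1 * `|x - t|.
  move=> Ot; have x1 := Ox; have t1 := Ot; rewrite !OmegaE in x1 t1.
  have [tx|/ltW xt] := leP t x.
    rewrite [`|x - t|]ger0_norm ?subr_ge0//.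
    have := slope t x ltac:(lra) tx ltac:(lra); rewrite ler_norml.
    have : 0 <= (d - p) * (x - t) by rewrite mulr_ge0//; lra.
    have : 0 <= (p + V1 - d) * (x - t) by rewrite mulr_ge0//; lra.
    lra.
  rewrite [`|x - t|]ler0_norm ?subr_le0//.
  have := slope x t ltac:(lra) xt ltac:(lra); rewrite ler_norml.
  have : 0 <= (d - p) * (t - x) by rewrite mulr_ge0//; lra.
  have : 0 <= (p + V1 - d) * (t - x) by rewrite mulr_ge0//; lra.
  lra.
pose A : R := 2 / pi * (V0 - 2 * `|d|); pose B : R := (1 - 2 / pi) * V1.
have l1 : 0 < 2 / pi :> R by rewrite divr_gt0.
have l2 : 2 / pi <= 1 :> R by rewrite ler_pdivrMr// mul1r; exact: pi_ge2.
have pw t : Omega t -> `|(f x - d * x) - (f t - d * t)| <= A + B * (1 - x * t).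
  move=> Ot; have x1 := Ox; have t1 := Ot; rewrite !OmegaE in x1 t1.
  have d1 : `|x - t| <= 1 - x * t by rewrite ler_norml; nra.
  have h1 := dosc x t Ox Ot.
  have h2 : `|(f x - d * x) - (f t - d * t)| <= V1 * (1 - x * t).
    by apply: le_trans (lip t Ot) _; rewrite ler_wpM2l.
  rewrite /A /B; move: h1 h2; set Z := `|_ - _|; set l := 2 / pi in l1 l2 *.
  move=> h1 h2.
  have : l * Z <= l * (V0 - 2 * `|d|) by rewrite ler_wpM2l// ltW.
  have : (1 - l) * Z <= (1 - l) * (V1 * (1 - x * t)) by rewrite ler_wpM2l//; lra.
  by lra.
pose G t := (f x - d * x) - (f t - d * t).
have bid : bounded_measurable (fun t : R => t).
  split; first exact: measurable_id.
  by exists 1 => t; rewrite OmegaE ler_norml; lra.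
have bG : bounded_measurable G.
  apply: bounded_measurableB; first exact: bounded_measurable_cst.
  by apply: bounded_measurableB => //; exact: bounded_measurableZ.
have wid : wint (fun t : R => t) = 0.
  rewrite (eq_wint (g := chebyshevT 1)) ?wint_chebyshevT// => t; rewrite OmegaE => t1.
  by rewrite chebyshevT1//; lra.
have bAB : bounded_measurable (fun t => (A + B) - (B * x) * t).
  apply: bounded_measurableB; first exact: bounded_measurable_cst.
  exact: bounded_measurableZ.
have wlin (c e : R) : wint (fun t => c - e * t) = c * pi.
  have := @wintB R (fun=> c) (fun t => e * t) (bounded_measurable_cst c) (bounded_measurableZ e bid).
  by rewrite wintZ// wid mulr0 subr0 wint_cst => <-.
have wG : `|wint G| <= (A + B) * pi.
  rewrite -(wlin _ (B * x)); apply: le_trans (wint_norm bG) _.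
  apply: le_wint => //.
    split; first by apply: measurableT_comp => //; case: bG.
    by case: bG => _ [M HM]; exists M => t Ot; rewrite /= normr_id HM.
  by move=> t Ot; have := pw t Ot; rewrite /G /=; lra.
rewrite chebyshev_errorE//.
rewrite (eq_wint (g := fun t => 2^-1 * (G \+ (fun t => d * x - d * t)) t)); last first.
  by move=> t _; rewrite /chebyshev_kernel /G /= big_geq// addr0; lra.
have blin : bounded_measurable (fun t => d * x - d * t).
  apply: bounded_measurableB; first exact: bounded_measurable_cst.
  exact: bounded_measurableZ.
rewrite wintZ; last exact: bounded_measurableD.
rewrite wintD// wlin.
have -> : 2 / pi * (2^-1 * (wint G + d * x * pi)) = wint G / pi + d * x.
  have : pi^-1 * pi = 1 :> R by rewrite mulVf// gt_eqF.
  by move/(congr1 ( *%R (d * x))); lra.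
apply: le_trans (ler_normD _ _) _.
have h1 : `|wint G / pi| <= A + B.
  by rewrite normrM normfV (gtr0_norm pi0) ler_pdivrMr.
have h2 : `|d * x| <= `|d|.
  rewrite normrM ler_piMr//; move: Ox; rewrite OmegaE ler_norml; lra.
(* Here the constants are used: [4 / pi >= 1] and [1 - 2 / pi <= 4 / (3 pi)]. *)
have h3 : `|d| <= 4 / pi * `|d|.
  by rewrite ler_peMl// ler_pdivlMr//; lra.
have h4 : B <= 4 / (3 * pi) * V1.
  rewrite /B ler_wpM2r//; rewrite ler_pdivlMr ?mulr_gt0//.
  have : pi^-1 * pi = 1 :> R by rewrite mulVf// gt_eqF.
  by lra.
by rewrite /A in h1; lra.
Qed.

End first_order.

(** * The error bounds *)

Section assembly.
Context {R : realType}.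
Notation mu := (@lebesgue_measure R).
Implicit Types (f g : R -> R) (v : nat -> R -> R) (x y V B : R) (n m k N : nat).

Lemma TV_Omega_ge0 f : (0 <= TV_Omega f)%E.
Proof.
apply: ereal_sup_ubound; exists (0, 0) => /=; first by split; [|split]; lra.
by rewrite total_variationxx.
Qed.

Lemma Linf_norm_le f (B : R) : 0 <= B ->
  {ae mu, forall x, Omega x -> `|f x| <= B} -> (Linf_norm f <= B%:E)%E.
Proof.
move=> B0 aef; rewrite /Linf_norm unlock /=; case: ifPn => _; last by rewrite lee_fin.
apply/ess_supP; have [N [mN N0 HN]] := aef.
exists (N `|` ~` Omega); split.
- by apply: measurableU => //; apply: measurableC; exact: measurable_Omega.
- transitivity (mu ((N `|` ~` Omega) `&` Omega)); first by [].
  rewrite setIUl setICl setU0.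
  apply/eqP; rewrite eq_le measure_ge0 andbT -N0.
  apply: le_measure; rewrite ?inE//.
    by apply: measurableI => //; exact: measurable_Omega.
- move=> x /= h; have [Ox|Ox] := pselect (Omega x); [left|by right].
  by apply: HN => /= h'; apply: h; rewrite lee_fin h'.
Qed.

Lemma chebyshev_coef_ae f g n :
  measurable_fun (Omega : set (measurableTypeR R)) f ->
  measurable_fun (Omega : set (measurableTypeR R)) g ->
  {ae mu, forall x, Omega x -> f x = g x} ->
  chebyshev_coef f n = chebyshev_coef g n.
Proof.
move=> mf mg fg; rewrite /chebyshev_coef; congr (_ * _).
have mk : measurable_fun (Omega : set (measurableTypeR R)) (chebyshevT n \* weight).
  by apply/measurable_EFinP; apply: measurable_int (chebyshevT_weight_integrable n).
congr fine; apply: ae_eq_integral; first exact: measurable_Omega.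
- by apply/measurable_EFinP; apply: measurable_funM.
- by apply/measurable_EFinP; apply: measurable_funM.
- by apply: (@filterS _ _ (ae_filter_ringOfSetsType mu) _ _ _ fg) => x /= E Ox; rewrite E.
Qed.

Lemma chebyshev_error_ae u f N B :
  mu.-integrable (Omega : set R) (EFin \o u) -> bounded_measurable f ->
  {ae mu, forall x, Omega x -> u x = f x} ->
  (forall x, Omega x -> `|f x - chebyshev_sum N f x| <= B) ->
  (Linf_norm (u \- chebyshev_sum N u)%R <= B%:E)%E.
Proof.
move=> iu [mf _] uf fB.
have mu_ : measurable_fun (Omega : set (measurableTypeR R)) u.
  by apply/measurable_EFinP; exact: measurable_int iu.
have sumE x : chebyshev_sum N u x = chebyshev_sum N f x.
  rewrite /chebyshev_sum (chebyshev_coef_ae 0 mu_ mf uf); congr (_ + _).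
  by apply: eq_bigr => n _; rewrite (chebyshev_coef_ae n mu_ mf uf).
apply: Linf_norm_le.
  by apply: le_trans (fB 0 _) => //; rewrite OmegaE; lra.
apply: (@filterS _ _ (ae_filter_ringOfSetsType mu) _ _ _ uf) => x /= E Ox.
by rewrite sumE E// fB.
Qed.

Section derivative_chain.
Variables (m : nat) (v : nat -> R -> R).
Hypothesis acv : forall k, (k < m)%N -> absolutely_continuous (-1) 1 (v k).
Hypothesis dv : forall k, (k < m)%N ->
  {ae mu, forall x, Omega x -> is_derive x (1 : R) (v k) (v k.+1 x)}.
Variable V : R.
Hypothesis TVv : (TV_Omega (v m) <= V%:E)%E.

Lemma derivatives_bounded_measurable k : (k <= m)%N -> bounded_measurable (v k).
Proof.
rewrite leq_eqVlt => /predU1P[->|km]; first exact: TV_Omega_bounded_measurable TVv.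
exact: absolutely_continuous_bounded_measurable (acv km).
Qed.

Lemma continuous_Omega f : absolutely_continuous (-1) 1 f ->
  {in (Omega : set R), continuous f}.
Proof.
move=> acf x; rewrite inE OmegaE => x1.
have le11 : -1 < 1 :> R by lra.
have /(continuous_within_itvP _ le11) [cf _ _] := absolutely_continuous_within le11 acf.
by apply: cf; rewrite in_itv.
Qed.

Lemma derivatives_lipschitz : (0 < m)%N -> exists L, forall x y, Omega x -> Omega y ->
  `|v 0%N x - v 0%N y| <= L * `|x - y|.
Proof.
move=> m0; have bv1 := derivatives_bounded_measurable m0.
have [_ [L HL]] := bv1.
have gL x : Omega x -> - L <= v 1%N x <= L by move=> /HL; rewrite ler_norml.
have slope := absolutely_continuous_slope (acv m0) bv1 (dv m0) gL.
exists L => x y; rewrite !OmegaE => x1 y1.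
have [yx|/ltW xy] := leP y x.
  rewrite [`|x - y|]ger0_norm ?subr_ge0// ler_norml.
  have := slope y x ltac:(lra) yx ltac:(lra); lra.
rewrite [`|x - y|]ler0_norm ?subr_le0// ler_norml.
have := slope x y ltac:(lra) xy ltac:(lra); lra.
Qed.

Lemma derivatives_error_tail N B x : (0 < m)%N -> Omega x ->
  (forall M, (N <= M)%N -> \sum_(N.+1 <= n < M.+1) `|chebyshev_coef (v 0%N) n| <= B) ->
  `|v 0%N x - chebyshev_sum N (v 0%N) x| <= B.
Proof.
move=> m0 Ox; have [L HL] := derivatives_lipschitz m0.
apply: (@chebyshev_error_tail R _ x L) => //.
- exact: derivatives_bounded_measurable.
- exact: continuous_Omega (acv m0).
- by move=> y Oy; exact: HL.
Qed.

Lemma TV_bound_ge0 : 0 <= V.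
Proof.
have O0 : Omega (0 : R) by rewrite OmegaE; lra.
by apply: le_trans (TV_Omega_osc TVv O0 O0).
Qed.

Lemma error_few_derivatives N x : (0 < m)%N -> (m <= N)%N -> Omega x ->
  `|v 0%N x - chebyshev_sum N (v 0%N) x| <=
  2 / (m%:R * pi) * step2_prod (N%:R - m%:R + 1) m * V.
Proof.
move=> m0 mN Ox; apply: derivatives_error_tail => // M NM.
apply: le_trans (chebyshev_coef_tail m0 mN NM acv dv TVv) _.
apply: ler_wpM2r; first exact: TV_bound_ge0.
rewrite [leRHS]mulrAC ler_pM2r; last by rewrite invr_gt0 mulr_gt0 ?ltr0n// pi_gt0.
have mN' : m%:R <= N%:R :> R by rewrite ler_nat.
have := @step2_prod_le R (N%:R - m%:R + 1) (N%:R - m%:R + 2) m; lra.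
Qed.

Lemma step2_prod1 n : step2_prod 1 n.+1 = (odd_dfact n)%:R^-1 :> R.
Proof.
rewrite /step2_prod /odd_dfact natr_prod -prodfV; apply: eq_bigr => j _.
by rewrite natrD natrM addrC.
Qed.

Lemma odd_dfact_gt0 n : 0 < (odd_dfact n)%:R :> R.
Proof. by rewrite -invr_gt0 -step2_prod1 step2_prod_gt0. Qed.

(** An equality for [n = 2]; each further factor is smaller in the even product. *)
Lemma step2_prod12 n : (1 < n)%N -> 8 * step2_prod 2 n <= 3 * step2_prod 1 n :> R.
Proof.
elim: n => // -[//|n] IH _; case: n IH => [_|n IH].
  rewrite /step2_prod !big_ord_recr !big_ord0/= mulr0 !addr0 mulr1 !mul1r invr1.
  have -> : 2 + 2 = 4 :> R by lra.
  have -> : 1 + 2 = 3 :> R by lra.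
  lra.
rewrite step2_prodSr [in leRHS]step2_prodSr; have h := IH isT.
have p1 : 0 < step2_prod 2 n.+2 :> R by apply: step2_prod_gt0.
have n0 : 0 <= 2 * n.+2%:R :> R by rewrite mulr_ge0.
apply: (@le_trans _ _ (8 * step2_prod 2 n.+2 / (1 + 2 * n.+2%:R))).
  rewrite mulrA ler_pM2l; last by rewrite mulr_gt0.
  by rewrite lef_pV2 ?posrE; lra.
by rewrite mulrA ler_pM2r ?invr_gt0//; lra.
Qed.

(** Bounding the even product by the odd one would give the factor [(2 m + 1) / m]
in place of [2]; the comparison above is sharp enough as soon as [m >= 2], but
the inequality fails for [m = 1]. *)
Lemma tail_sharp : (1 < m)%N ->
  (step2_prod 1 m + step2_prod 2 m) / (m%:R * pi) <=
  2 / pi * (2 / (odd_dfact m)%:R) :> R.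
Proof.
move=> m1; have := step2_prod12 m1; rewrite -step2_prod1 step2_prodSr.
have := @step2_prod_gt0 R 1 m ltr01; have pi0 := @pi_gt0 R.
set a := step2_prod 1 m; set b := step2_prod 2 m => a0 ba.
have m2 : 2 <= m%:R :> R by rewrite ler_nat.
have -> : 2 / pi * (2 * (a / (1 + 2 * m%:R))) = 4 * a / (1 + 2 * m%:R) / pi.
  by move: pi^-1 (1 + 2 * m%:R)^-1 => c d; lra.
rewrite invfM mulrA ler_pM2r ?invr_gt0// ler_pdivlMr; last lra.
rewrite mulrAC ler_pdivrMr; last lra.
have : 0 <= a * (m%:R - 2) by rewrite mulr_ge0 ?subr_ge0// ltW.
have : b * m%:R <= 3 / 8 * a * m%:R by rewrite ler_wpM2r//; lra.
lra.
Qed.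

(** The coefficient of order [n + 1] is estimated by the variation of the [n]-th
derivative, the largest order to which the coefficient bound applies, as long as
[n < m]; the tail beyond [m] is estimated by the variation of the [m]-th one. *)
Lemma error_many_derivatives N x (W : nat -> R) : (1 < m)%N -> (N < m)%N ->
  Omega x -> (forall n, (N <= n <= m)%N -> (TV_Omega (v n) <= (W n)%:E)%E) ->
  W m = V ->
  `|v 0%N x - chebyshev_sum N (v 0%N) x| <=
  2 / pi * (\sum_(N <= n < m) W n / (odd_dfact n)%:R + 2 / (odd_dfact m)%:R * V).
Proof.
move=> m1 Nm Ox WV WmV; have m0 := ltnW m1.
apply: derivatives_error_tail => // M NM.
have pi0 := @pi_gt0 R.
(* Summing further than [m] puts the two kinds of coefficients in the sum. *)
have mM := leq_maxr M m; set M' := maxn M m in mM.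
apply: (@le_trans _ _ (\sum_(N.+1 <= n < M'.+1) `|chebyshev_coef (v 0%N) n|)).
  rewrite [leRHS](big_cat_nat (n := M.+1))//=; last by rewrite ltnS leq_maxl.
  by rewrite lerDl sumr_ge0.
rewrite (big_cat_nat (n := m.+1) (leqW Nm))//= mulrDr; apply: lerD.
  rewrite big_add1/= mulr_sumr big_nat_cond [leRHS]big_nat_cond.
  apply: ler_sum => n /andP[/andP[Nn nm] _].
  have := @chebyshev_coef_smooth R n v (W n) n.+1.
  rewrite -[n.+1%:R]natr1 [n%:R + 1]addrC addrK step2_prod1; apply => //.
  - by move=> j jn; apply: acv; exact: ltn_trans nm.
  - by move=> j jn; apply: dv; exact: ltn_trans nm.
  - by apply: WV; rewrite Nn ltnW.
apply: le_trans (chebyshev_coef_tail m0 (leqnn m) mM acv dv TVv) _.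
rewrite mulrA; apply: ler_wpM2r; first exact: TV_bound_ge0.
by rewrite subrr !add0r; exact: tail_sharp.
Qed.

End derivative_chain.

End assembly.

Theorem theorem2 (R : realType) (m N : nat) (u : R -> R) (hu : W m u)
    (v : nat -> R -> R) (hv : derivatives m u v) :
  [/\ (1 <= m)%N -> (m <= N)%N ->
      (Linf_norm (u \- chebyshev_sum N u)%R <=
       (2 / (m%:R * pi) *
        \prod_(1 <= j < m.+1) (1 / (N%:R - m%:R + 2 * j%:R - 1)))%R%:E
       * TV_Omega (v m))%E,
      m = 0%N -> (1 <= N)%N ->
      (Linf_norm (u \- chebyshev_sum N u)%R <= TV_Omega (v 0%N))%E &
      (N + 1 <= m)%N ->
      (Linf_norm (u \- chebyshev_sum N u)%R <=
       (2 / ((odd_dfact N)%:R * pi))%R%:E *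
       \sum_(N <= n < m.+1)
         ((if n == m then 2 else 1) *
          ((odd_dfact N)%:R / (odd_dfact n)%:R))%R%:E * TV_Omega (v n))%E].
Proof.
have [iu _] := hu; have [uv acv dv] := hv; have pi0 := @pi_gt0 R.
split.
- move=> m0 mN.
  have prodE : \prod_(1 <= j < m.+1) (1 / (N%:R - m%:R + 2 * j%:R - 1)) =
      step2_prod (N%:R - m%:R + 1) m :> R.
    rewrite big_add1 big_mkord; apply: eq_bigr => j _.
    by rewrite div1r -[j.+1%:R]natr1; congr (_^-1); lra.
  have mN' : m%:R <= N%:R :> R by rewrite ler_nat.
  have c0 : 0 < 2 / (m%:R * pi) * step2_prod (N%:R - m%:R + 1) m :> R.
    by rewrite mulr_gt0 ?divr_gt0 ?mulr_gt0 ?ltr0n// step2_prod_gt0//; lra.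
  rewrite prodE; have := TV_Omega_ge0 (v m); case E : (TV_Omega (v m)) => [V| |]//= _.
    rewrite -EFinM; have TVv : (TV_Omega (v m) <= V%:E)%E by rewrite E.
    apply: chebyshev_error_ae iu _ uv _.
      exact: (derivatives_bounded_measurable acv TVv).
    by move=> x Ox; exact: error_few_derivatives.
  by rewrite gt0_muley ?leey// lte_fin.
- move=> m0 N1; subst m.
  have := TV_Omega_ge0 (v 0%N); case E : (TV_Omega (v 0%N)) => [V| |]//= _; last exact: leey.
  have TVv : (TV_Omega (v 0%N) <= V%:E)%E by rewrite E.
  apply: chebyshev_error_ae iu _ uv _; first exact: TV_Omega_bounded_measurable TVv.
  by move=> x Ox; exact: chebyshev_error_TV.
- rewrite addn1 => Nm.
  have d0 n := @odd_dfact_gt0 R n.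
  have c0 n : 0 < ((if n == m then 2 else 1) * ((odd_dfact N)%:R / (odd_dfact n)%:R)) :> R.
    by rewrite mulr_gt0 ?divr_gt0//; case: ifP.
  have C0 : 0 < 2 / ((odd_dfact N)%:R * pi) :> R by rewrite divr_gt0// mulr_gt0.
  (* One infinite variation among the summands makes the bound infinite. *)
  have [fin|] := pselect (forall n, (N <= n <= m)%N -> (TV_Omega (v n) < +oo)%E); last first.
    move=> /existsNP[n /not_implyP[/andP[Nn nm] /negP]].
    rewrite -leNgt leye_eq => /eqP E.
    rewrite (bigD1_seq n) ?iota_uniq//=; last by rewrite mem_index_iota Nn ltnS nm.
    rewrite E gt0_muley ?lte_fin// addye; last first.
      rewrite gt_eqF// (lt_le_trans (ltNyr 0))// sume_ge0// => k _.
      by rewrite mule_ge0 ?TV_Omega_ge0// lee_fin ltW.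
    by rewrite gt0_muley ?leey// lte_fin.
  pose W n := fine (TV_Omega (v n)).
  have WE n : (N <= n <= m)%N -> TV_Omega (v n) = (W n)%:E.
    by move=> nm; rewrite fineK// ge0_fin_numE ?fin// TV_Omega_ge0.
  have TVv : (TV_Omega (v m) <= (W m)%:E)%E by rewrite WE// leqnn (ltnW Nm).
  rewrite big_nat_cond (eq_bigr (fun n => (((if n == m then 2 else 1) *
      ((odd_dfact N)%:R / (odd_dfact n)%:R)) * W n)%:E)); last first.
    by move=> n /andP[/andP[Nn nm] _]; rewrite WE ?EFinM// Nn.
  rewrite -big_nat_cond sumEFin -EFinM.
  apply: chebyshev_error_ae iu _ uv _; first exact: (derivatives_bounded_measurable acv TVv).
  move=> x Ox.
  have RHSE : 2 / ((odd_dfact N)%:R * pi) * (\sum_(N <= n < m.+1)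
      ((if n == m then 2 else 1) * ((odd_dfact N)%:R / (odd_dfact n)%:R)) * W n) =
    2 / pi * (\sum_(N <= n < m) W n / (odd_dfact n)%:R + 2 / (odd_dfact m)%:R * W m) :> R.
    rewrite big_nat_recr ?(ltnW Nm)//= eqxx.
    rewrite (eq_big_nat _ _ (F2 := fun n => (odd_dfact N)%:R * (W n / (odd_dfact n)%:R))); last first.
      by move=> n /andP[_ nm]; rewrite ltn_eqF// mul1r; lra.
    rewrite -mulr_sumr; set S := \sum_(_ <= _ < _) _.
    have := @mulVf R _ (lt0r_neq0 (d0 N)); rewrite invfM.
    move: pi^-1 (odd_dfact m)%:R^-1 => c e.
    move: (odd_dfact N)%:R^-1 => a; move: (odd_dfact N)%:R => b ab.
    by have := congr1 ( *%R (2 * c * (S + 2 * e * W m))) ab; lra.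
  rewrite RHSE.
  have [m1|m1] := ltnP 1 m.
    apply: (error_many_derivatives acv dv TVv m1 Nm Ox) => // n nm.
    by rewrite WE.
  have m1' : m = 1%N by apply/eqP; rewrite eqn_leq m1 (leq_ltn_trans _ Nm).
  subst m; have N0 : N = 0%N by case: N Nm {RHSE WE fin c0 C0 W TVv} .
  subst N.
  have h := chebyshev_mean_error (acv 0%N isT) (dv 0%N isT) _ TVv Ox.
  apply: le_trans (h (W 0%N) _) _; first by rewrite WE.
  rewrite big_nat1 /odd_dfact !big_ord_recr !big_ord0/= !mul1n.
  rewrite -[(2 * 0 + 1)%N]/1%N -[(2 * 1 + 1)%N]/3%N divr1 invfM.
  by move: pi^-1 => c; lra.
Qed.
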